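(* Let $W \in \mathbb{R}^{s\times m}$, $q \in \mathbb{R}^m$, and let $\mu$ be a Borel probability measure on $\mathbb{R}^s$. Assume: (A1) For every $t \in \mathbb{R}^s$ there exists some $y \in \mathbb{R}^m$, $y \geq 0$, with $Wy = t$. (A2) There exists some $\xi \in \mathbb{R}^s$ with $W^\top \xi < q$ (componentwise strict inequality). (A3) $\int_{\mathbb{R}^s} \|z\| \,\mu(\mathrm{d}z) < \infty$. (A4) $\mu$ has a density $\theta$ with respect to Lebesgue measure on $\mathbb{R}^s$, and $V \subset \mathbb{R}^s$ is a convex open set for which there are constants $r, \rho > 0$ such that $\theta \geq r$ Lebesgue-almost everywhere on $V + B_\rho(0)$. (A5) For every $x \in \mathbb{R}^s$, the set $\{ z \in \mathbb{R}^s \mid \varphi(z-x) = 0 \}$ has $\mu$-measure zero, where $\varphi(t) := \min\{ q^\top y \mid Wy = t,\ y \geq 0 \}$. Let $$Q_{\mathbb{E}}(x) := \int_{\mathbb{R}^s} \varphi(z-x)\, \mu(\mathrm{d}z), \qquad Q_{D_+}(x) := \int_{\mathbb{R}^s} \max\{ Q_{\mathbb{E}}(x), \varphi(z-x) \}\, \mu(\mathrm{d}z).$$ Then there exists a continuous function $C : \mathbb{R}^s \to [0,\infty)$ with $C(u) \to 0$ as $\|u\| \to 0$ and $C(u) > 0$ for all $u \neq 0$, such that $$[Q'_{D_+}(x+u) - Q'_{D_+}(x)]\,u \geq C(u)\, \|u\|^2$$ for all $x, u$ with $x, x+u \in V$. If, in addition, (A6) $q \geq 0$ (componentwise) holds,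 then $Q_{D_+}$ is strongly convex on $V$.
   Context: $\|\cdot\|$ is the Euclidean norm and $B_\rho(0)$ the open ball of radius $\rho$ centered at $0$ in $\mathbb{R}^s$; vector inequalities are componentwise. Under (A1) and (A2) the function $\varphi$ is finite on all of $\mathbb{R}^s$, and under (A1)-(A3) $Q_{\mathbb{E}}$ and $Q_{D_+}$ are well defined, real-valued and convex on $\mathbb{R}^s$; under (A1)-(A5) they are differentiable. A prime denotes the derivative, regarded as a row vector, so $Q'(x)u$ is the directional derivative of $Q$ at $x$ in direction $u$. A function $f$ is strongly convex on a convex set $V$ if there exists $\kappa > 0$ such that for all $x, x' \in V$ and all $\lambda \in [0,1]$, $$f(\lambda x' + (1-\lambda) x) \leq \lambda f(x') + (1-\lambda) f(x) - \frac{\kappa}{2} \lambda(1-\lambda) \|x'-x\|^2.$$ *)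

(* Defs.v *)
From HB Require Import structures.
From mathcomp Require Import all_boot all_order all_algebra.
From mathcomp Require Import all_classical all_reals all_analysis measurable_realfun.

Set Implicit Arguments.
Unset Strict Implicit.
Unset Printing Implicit Defensive.

Import Order.TTheory GRing.Theory Num.Theory.
Import numFieldNormedType.Exports.

Local Open Scope classical_set_scope.
Local Open Scope ring_scope.

Definition mx_borel_display : measure_display.
Proof. exact. Qed.

(* Matrices (hence 'cV[R]_s) carry the Borel sigma-algebra of their topology. *)
HB.instance Definition _ (R : realType) (m n : nat) :=
  @isMeasurable.Build mx_borel_display 'M[R]_(m, n)
  <<s (@open 'M[R]_(m, n)) >> (@sigma_algebra0 _ setT _)
  (@sigma_algebraC _ _) (@sigma_algebra_bigcup _ setT _).

Lemma measurable_fun_mx d (T : measurableType d) (R : realType) m n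
    (f : T -> 'M[R]_(m, n)) :
  (forall i j, measurable_fun setT (fun t => f t i j : R)) ->
  measurable_fun setT f.
Proof.
move=> mf; apply: (measurability (@open 'M[R]_(m, n))) => //.
move=> _ [U oU <-]; rewrite setTI.
pose c (p : 'M[rat]_(m, n) * rat) : set 'M[R]_(m, n) :=
  [set v | forall i j, `|v i j - ratr (p.1 i j)| < ratr p.2].
have -> : U = \bigcup_p (if `[< c p `<=` U >] then c p else set0).
  apply/seteqP; split=> [x Ux|x [p _]]; last first.
    by case: ifPn => // /asboolP; exact.
  have /nbhs_ballP[e /= e0 xeU] : nbhs x U by exact: open_nbhs_nbhs.
  have [r] : exists r : rat, ratr r \in `]0, (e / 2)[.
    by apply: rat_in_itvoo; rewrite divr_gt0.
  rewrite in_itv/= => /andP[r0 re].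
  have q_ i j : {q : rat | `|x i j - ratr q| < ratr r}.
    apply: cid; have [|q] := @rat_in_itvoo R (x i j - ratr r) (x i j + ratr r).
      by rewrite ltrBlDr -addrA ltrDl addr_gt0.
    by rewrite in_itv/= => qr; exists q; rewrite distrC ltr_distl.
  exists (\matrix_(i, j) sval (q_ i j), r) => //.
  have xc : c (\matrix_(i, j) sval (q_ i j), r) x.
    by move=> i j /=; rewrite mxE; exact: (svalP (q_ i j)).
  case: ifPn => // /asboolPn[] v cv; apply: xeU.
  split=> // i j; rewrite /ball/= (splitr e).
  apply: (le_lt_trans (ler_distD (ratr (sval (q_ i j))) _ _)).
  apply: ltrD; first exact: lt_trans (svalP (q_ i j)) re.
  by move: (cv i j) => /=; rewrite mxE distrC => /lt_trans; apply.
rewrite preimage_bigcup; apply: countable_bigcupT_measurable => // p.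
case: ifPn => _; last by rewrite preimage_set0.
have -> : f @^-1` c p = \bigcap_(ij in [set: 'I_m * 'I_n])
    [set t | `|f t ij.1 ij.2 - ratr (p.1 ij.1 ij.2)| < ratr p.2].
  apply/seteqP; split=> [t ct [i j] _|t ct i j]; first exact: ct.
  exact: (ct (i, j)).
apply: fin_bigcap_measurable => //= -[i j] _ /=.
have mg : measurable_fun setT (fun t => `|f t i j - ratr (p.1 i j)|).
  by apply: measurableT_comp => //; exact: measurable_funB.
rewrite -[X in measurable X]setTI.
have := mg measurableT _ (measurable_itv `]-oo, (ratr p.2)[).
by congr (measurable (_ `&` _)); apply/seteqP; split => t /=; rewrite in_itv.
Qed.

Lemma measurable_mx_coord (R : realType) m n (i : 'I_m) (j : 'I_n) :
  measurable_fun setT (fun M : 'M[R]_(m, n) => M i j : R).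
Proof.
apply: (measurability _ (RGenOpens.measurableE R)).
move=> _ [U oU <-]; rewrite setTI; apply: sub_sigma_algebra.
apply: open_comp; first by move=> M _; exact: coord_continuous.
by case: oU => a [b ->]; exact: interval_open.
Qed.

Section vec_cons.
Context {R : realType} {n : nat}.

Definition vec_cons (p : measurableTypeR R * 'cV[R]_n) : 'cV[R]_n.+1 :=
  col_mx (const_mx p.1 : 'cV[R]_1) p.2.

Lemma measurable_vec_cons : measurable_fun setT vec_cons.
Proof.
apply: measurable_fun_mx => i j; rewrite ord1.
rewrite (_ : (fun t => _) = fun t : measurableTypeR R * 'cV[R]_n =>
  match fintype.split (i : 'I_(1 + n)) with
  inl _ => t.1 | inr k => t.2 k 0 end); last first.
  by apply/funext => t; rewrite mxE; case: fintype.split => k; rewrite ?mxE.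
case: fintype.split => k; first exact: measurable_fst.
exact: (measurableT_comp (measurable_mx_coord k 0)).
Qed.

HB.instance Definition _ := isMeasurableFun.Build _ _ _ _ vec_cons
  measurable_vec_cons.

Variable nu : {sigma_finite_measure set 'cV[R]_n -> \bar R}.

(* Product of the one-dimensional Lebesgue measure with nu, transported from
   R * R^n to R^n.+1. *)
Definition leb_cons : set 'cV[R]_n.+1 -> \bar R :=
  pushforward (lebesgue_measure \x nu)%E vec_cons.

Let leb_cons0 : leb_cons set0 = 0%E.
Proof. exact: measure0. Qed.

Let leb_cons_ge0 A : (0 <= leb_cons A)%E.
Proof. exact: measure_ge0. Qed.

Let leb_cons_sigma_additive : semi_sigma_additive leb_cons.
Proof. exact: measure_semi_sigma_additive. Qed.

HB.instance Definition _ := isMeasure.Build _ _ _ leb_cons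
  leb_cons0 leb_cons_ge0 leb_cons_sigma_additive.

Let leb_cons_sigma_finite : sigma_finite setT leb_cons.
Proof.
have [F FT mF] : sigma_finite setT (lebesgue_measure \x nu)%E.
  have /sigma_finiteP[A [AT ndA mA]] := sigma_finiteT (@lebesgue_measure R).
  have /sigma_finiteP[B [BT ndB mB]] := sigma_finiteT nu.
  exists (fun k => A k `*` B k) => [|k].
    apply/seteqP; split => // -[x y] _.
    have [i _ Ax] : (\bigcup_i A i) x by rewrite -AT.
    have [j _ By] : (\bigcup_i B i) y by rewrite -BT.
    exists (maxn i j) => //; split.
      by move: x Ax; exact/subsetPset/ndA/leq_maxl.
    by move: y By; exact/subsetPset/ndB/leq_maxr.
  have [mAk Ak] := mA k; have [mBk Bk] := mB k.
  split; first exact: measurableX.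
  by rewrite product_measure1E// lte_mul_pinfty// ge0_fin_numE.
pose h (v : 'cV[R]_n.+1) : measurableTypeR R * 'cV[R]_n :=
  ((v : 'cV[R]_(1 + n)) (lshift n 0) 0, dsubmx (v : 'cV[R]_(1 + n))).
exists (fun i => h @^-1` F i).
  by rewrite -preimage_bigcup -FT preimage_setT.
move=> i; split.
  rewrite -[X in measurable X]setTI; apply: (_ : measurable_fun _ h) => //.
    apply/measurable_fun_pairP; split; first exact: measurable_mx_coord.
    apply: measurable_fun_mx => k l.
    rewrite (_ : (fun t => _) = fun t : 'cV[R]_n.+1 =>
      t (rshift 1 k : 'I_n.+1) l); first exact: measurable_mx_coord.
    by apply/funext => t; rewrite /= mxE.
  by have [] := mF i.
rewrite /leb_cons/pushforward -comp_preimage (_ : h \o vec_cons = id).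
  by have [] := mF i.
by apply/funext => -[x v]; rewrite /h /vec_cons /= col_mxEu mxE col_mxKd.
Qed.

HB.instance Definition _ := Measure_isSigmaFinite.Build _ _ _ leb_cons
  leb_cons_sigma_finite.

End vec_cons.

Fixpoint lebesgue_vec (R : realType) (n : nat) :
    {sigma_finite_measure set 'cV[R]_n -> \bar R} :=
  match n with
  | 0 => dirac (0 : 'cV[R]_0)
  | n'.+1 => leb_cons (lebesgue_vec R n')
  end.

Lemma lebesgue_vec_box (R : realType) n (a b : 'cV[R]_n) :
  (forall i, a i 0 <= b i 0) ->
  lebesgue_vec R n [set v : 'cV[R]_n | forall i, a i 0 <= v i 0 <= b i 0] =
  (\prod_i (b i 0 - a i 0))%:E.
Proof.
elim: n a b => [|n IH] a b ab.
  by rewrite big_ord0 /= diracE mem_set// => -[].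
pose t (x : 'cV[R]_n.+1) : 'cV[R]_n := \col_i x (lift ord0 i) 0.
have mbox k (c d : 'cV[R]_k) :
    measurable [set v : 'cV[R]_k | forall i, c i 0 <= v i 0 <= d i 0].
  rewrite (_ : [set _ | _] = \bigcap_(i in [set: 'I_k])
    (fun v : 'cV[R]_k => v i 0 : R) @^-1` `[c i 0, d i 0]).
    apply: fin_bigcap_measurable => // i _; rewrite -[X in measurable X]setTI.
    exact: (measurable_mx_coord i 0 measurableT (measurable_itv _)).
  apply/seteqP; split => v /= cd i.
    by move=> _ /=; rewrite in_itv/=; exact: cd.
  by have /= := cd i I; rewrite in_itv.
have vc0 (p : measurableTypeR R * 'cV[R]_n) : vec_cons p ord0 0 = p.1.
  by rewrite /vec_cons mxE; case: splitP => // k _; rewrite mxE.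
have vcS (p : measurableTypeR R * 'cV[R]_n) (i : 'I_n) :
    vec_cons p (lift ord0 i) 0 = p.2 i 0.
  rewrite /vec_cons mxE; case: splitP => [k|k [/val_inj->//]].
  by rewrite ord1.
transitivity ((lebesgue_measure \x lebesgue_vec R n)%E
    (`[a ord0 0, b ord0 0] `*`
     [set v : 'cV[R]_n | forall i, t a i 0 <= v i 0 <= t b i 0])).
  rewrite /= /leb_cons /pushforward; congr (product_measure1 _ _ _).
  apply/seteqP; split => [p /= ap|p /= [p1 p2] i].
    rewrite in_itv/= -vc0; split=> [|i]; first exact: ap.
    by rewrite !mxE -vcS; exact: ap.
  case: (unliftP ord0 i) => [j|] ->; last by rewrite vc0; rewrite in_itv in p1.
  by rewrite vcS; have := p2 j; rewrite !mxE.
rewrite product_measure1E//; last exact: mbox.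
rewrite IH => [|i]; last by rewrite !mxE.
rewrite [X in (X * _)%E]lebesgue_measure_itv/= lte_fin big_ord_recl EFinM.
congr (_ * _)%E; last by congr EFin; apply: eq_bigr => i _; rewrite !mxE.
case: ltgtP (ab ord0) => // -> _; by rewrite subrr.
Qed.

Section definitions.
Context {R : realType}.

(* The library norm on matrices is the max norm. *)
Definition enorm {n : nat} (x : 'cV[R]_n) : R :=
  Num.sqrt (\sum_i x i 0 ^+ 2).

Definition eball {n : nat} (rho : R) : set 'cV[R]_n :=
  [set x | enorm x < rho].

(* The least element of S; 0 by convention if there is none. *)
Definition set_min (S : set R) : R := xget 0 (S `&` lbound S).

Definition lp_value {s m : nat} (W : 'M[R]_(s, m)) (q : 'cV[R]_m)
    (t : 'cV[R]_s) : R :=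
  set_min [set (q^T *m y) 0 0 | y in
    [set y : 'cV[R]_m | W *m y = t /\ forall j, 0 <= y j 0]].

Definition QE {s m : nat} (W : 'M[R]_(s, m)) (q : 'cV[R]_m)
    (mu : probability 'cV[R]_s R) (x : 'cV[R]_s) : R :=
  \int[mu]_z lp_value W q (z - x).

Definition QDplus {s m : nat} (W : 'M[R]_(s, m)) (q : 'cV[R]_m)
    (mu : probability 'cV[R]_s R) (x : 'cV[R]_s) : R :=
  \int[mu]_z Num.max (QE W q mu x) (lp_value W q (z - x)).

Definition is_density {s : nat} (theta : 'cV[R]_s -> R)
    (mu : probability 'cV[R]_s R) : Prop :=
  [/\ measurable_fun setT theta,
      forall z, 0 <= theta z &
      forall A : set 'cV[R]_s, measurable A ->
        mu A = (\int[lebesgue_vec R s]_(z in A) (theta z)%:E)%E].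

Definition strongly_convex_on {s : nat} (V : set 'cV[R]_s)
    (f : 'cV[R]_s -> R) : Prop :=
  exists2 kappa : R, 0 < kappa &
    forall x x' (lambda : R), V x -> V x' -> 0 <= lambda <= 1 ->
      f (lambda *: x' + (1 - lambda) *: x) <=
        lambda * f x' + (1 - lambda) * f x
        - kappa / 2 * lambda * (1 - lambda) * enorm (x' - x) ^+ 2.

End definitions.

(* Main.v *)
(* The value function phi = lp_value W q is finite, sublinear and Lipschitz, and
   phi(t) + phi(-t) >= c |t| with c > 0.

   Strong convexity of Q_E on V: the second difference of phi in direction v,
   summed over the translates of a small box by multiples of v, telescopes to a
   total change of slope of at least c |v| / 2, while every point is covered by
   O(1/|v|) translates. Hence the second difference has integral at least
   const * |v|^2 over a box, and the density bound r <= theta transfers this to mu.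

   Strong convexity of Q_D+: at a convex combination y of two points of V, every z
   with phi(z - y) <= Q_E(y) lets Q_E realize the maximum and contributes the full
   strong convexity gain, every other z preserves convexity. The mu-mass of these z is bounded below on V because V is
   bounded and the level sets of phi are null.

   Differentiability of Q_D+: a convex Lipschitz function is smooth along a given
   direction Lebesgue-almost everywhere (again by averaging over translates), this
   smoothness passes through the integral by dominated convergence, and a convex
   function that is smooth along the coordinate axes is differentiable. The
   monotonicity estimate follows from strong convexity, with
   C(u) = K min(1, |u|). *)

Require Import Defs.
From HB Require Import structures.
From mathcomp Require Import all_boot all_order all_algebra.
From mathcomp Require Import all_classical all_reals all_analysis measurable_realfun.
From mathcomp Require Import ring lra zify.

Set Implicit Arguments.
Unset Strict Implicit.
Unset Printing Implicit Defensive.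

Import Order.TTheory GRing.Theory Num.Theory.
Import numFieldNormedType.Exports.

Local Open Scope classical_set_scope.
Local Open Scope ring_scope.

(** * Convex functions and differentiability *)

Definition convex_fun (R : realType) (V : lmodType R) (f : V -> R) :=
  forall (x y : V) (t : R), 0 <= t <= 1 ->
    f (t *: x + (1 - t) *: y) <= t * f x + (1 - t) * f y.

Definition second_diff (R : realType) (V : lmodType R) (f : V -> R) (x v : V) :=
  f (x + v) + f (x - v) - 2 * f x.

(* For a convex f this says that t |-> f (x + t *: e) is differentiable at 0. *)
Definition smooth_along (R : realType) (V : lmodType R) (f : V -> R) (x e : V) :=
  forall eps : R, 0 < eps ->
    exists2 h : R, 0 < h & second_diff f x (h *: e) <= eps * h.

Section convex_functions.
Context {R : realType} {V : lmodType R}.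
Implicit Types (f : V -> R) (x v e : V).

Lemma second_diffN f x v : second_diff f x (- v) = second_diff f x v.
Proof. by rewrite /second_diff opprK; congr (_ - _); rewrite addrC. Qed.

Lemma convex_second_diff_ge0 f x v : convex_fun f -> 0 <= second_diff f x v.
Proof.
move=> cf; have := cf (x + v) (x - v) 2^-1.
have -> : 2^-1 *: (x + v) + (1 - 2^-1) *: (x - v) = x.
  have -> : 1 - 2^-1 = 2^-1 :> R by lra.
  by rewrite -scalerDr addrACA subrr addr0 -mulr2n -[x *+ 2]scaler_nat scalerA
    mulVf ?scale1r ?pnatr_eq0.
by rewrite /second_diff => /(_ ltac:(lra)); lra.
Qed.

Lemma convex_ray f x v (t : R) : convex_fun f -> 0 <= t <= 1 ->
  f (x + t *: v) - f x <= t * (f (x + v) - f x).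
Proof.
move=> cf t01; have := cf (x + v) x t t01.
have -> : t *: (x + v) + (1 - t) *: x = x + t *: v.
  by rewrite scalerDr addrAC -scalerDl addrC [t + _]addrC addrNK scale1r addrC.
by lra.
Qed.

Lemma convex_second_diff_scale f x v (t : R) : convex_fun f -> 0 <= t <= 1 ->
  second_diff f x (t *: v) <= t * second_diff f x v.
Proof.
move=> cf t01; have := convex_ray x v cf t01; have := convex_ray x (- v) cf t01.
by rewrite /second_diff scalerN; lra.
Qed.

(** The point [x] is the convex combination of [x - k *: e] and [x + h *: e] with weights
    [h / (h + k)] and [k / (h + k)]. *)
Lemma convex_slope f x e (h k : R) : convex_fun f -> 0 < h -> 0 < k ->
  (f x - f (x - k *: e)) / k <= (f (x + h *: e) - f x) / h.
Proof.
move=> cf h0 k0; have hk0 : 0 < h + k by lra.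
have := cf (x - k *: e) (x + h *: e) (h / (h + k)).
have -> : 1 - h / (h + k) = k / (h + k) by field; rewrite gt_eqF.
have -> : (h / (h + k)) *: (x - k *: e) + (k / (h + k)) *: (x + h *: e) = x.
  rewrite !scalerDr addrACA -scalerDl -mulrDl divff ?gt_eqF// scale1r.
  rewrite scalerN !scalerA (_ : h / (h + k) * k = k / (h + k) * h) ?addNr ?addr0//.
  by ring.
have h01 : 0 <= h / (h + k) <= 1.
  by rewrite ler_pdivrMr// mul1r ler_pdivlMr// mul0r; lra.
move=> /(_ h01) H; rewrite ler_pdivrMr// mulrAC ler_pdivlMr//.
have : f x * (h + k) <= h * f (x - k *: e) + k * f (x + h *: e).
  rewrite -ler_pdivlMr//; apply: le_trans H _; rewrite le_eqVlt; apply/orP; left.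
  by apply/eqP; field; rewrite gt_eqF.
by nra.
Qed.

(** The derivative is the infimum of the forward difference quotients, which the backward ones bound
    below. The remainder is then nonnegative on both sides, and the remainders at [t] and [- t] add
    up to a second difference, which smoothness bounds. *)
Lemma smooth_along_derivative f x e : convex_fun f -> smooth_along f x e ->
  exists d : R, forall eps : R, 0 < eps -> exists2 delta : R, 0 < delta &
    forall t : R, `|t| <= delta ->
      `|f (x + t *: e) - f x - t * d| <= eps * `|t|.
Proof.
move=> cf sf.
pose S := [set (f (x + h *: e) - f x) / h | h in [set h : R | 0 < h]].
have S0 : S !=set0 by exists ((f (x + 1 *: e) - f x) / 1), 1 => //=.
have lbS (k : R) : 0 < k -> lbound S ((f x - f (x - k *: e)) / k).
  by move=> k0 _ [h /= h0 <-]; exact: convex_slope.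
have hS : has_inf S by split => //; exists ((f x - f (x - 1 *: e)) / 1); exact: lbS.
have ge0 (t : R) : 0 <= f (x + t *: e) - f x - t * inf S.
  have [t0|t0|<-] := ltgtP 0 t; last by rewrite scale0r addr0 mul0r subrr subr0.
    have : inf S <= (f (x + t *: e) - f x) / t by apply: ge_inf; [case: hS|exists t].
    by rewrite ler_pdivlMr//; lra.
  have /lbS : 0 < - t by lra.
  move=> /(lb_le_inf S0); rewrite scaleNr opprK ler_pdivrMr ?oppr_gt0//; lra.
exists (inf S) => eps eps0; have [h h0 sdh] := sf _ eps0.
exists h => // t th; rewrite ger0_norm//.
have st : second_diff f x (t *: e) <= eps * `|t|.
  have -> : second_diff f x (t *: e) = second_diff f x (`|t| *: e).
    have [t0|t0] := lerP 0 t; first by rewrite ger0_norm.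
    by rewrite ltr0_norm// -second_diffN scaleNr.
  have -> : `|t| *: e = (`|t| / h) *: (h *: e) by rewrite scalerA divfK ?gt_eqF.
  apply: le_trans (convex_second_diff_scale _ _ cf _) _.
    by rewrite ler_pdivrMr// mul1r th andbT divr_ge0// ltW.
  rewrite mulrAC ler_pdivrMr// -mulrA [eps * _]mulrC -mulrA ler_wpM2l//.
  by rewrite mulrC.
have := ge0 t; have := ge0 (- t); move: st.
by rewrite /second_diff scaleNr; lra.
Qed.

End convex_functions.

Lemma ler_mx_norm_entry (R : realType) m n (M : 'M[R]_(m, n)) i j :
  `|M i j| <= `|M|.
Proof.
rewrite [leRHS]/Num.norm /= mx_normrE; exact: (le_bigmax _ _ (i, j)).
Qed.

Lemma lipschitz_fun_continuous (R : realType) (V W : normedModType R) (f : V -> W)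
    (L : R) : (forall x y, `|f x - f y| <= L * `|x - y|) -> continuous f.
Proof.
move=> fL x; apply/cvgrPdist_le => eps eps0.
have L1 : 0 < `|L| + 1 by rewrite ltr_wpDl.
near=> y; apply: le_trans (fL _ _) _.
have : `|x - y| <= eps / (`|L| + 1).
  by near: y; apply: cvgr_dist_le => //; rewrite divr_gt0.
rewrite ler_pdivlMr//; apply: le_trans.
rewrite mulrC ler_wpM2l// (le_trans (ler_norm _))// lerDl//.
Unshelve. all: by end_near.
Qed.

Lemma differentiable_eps (R : realType) (V W : normedModType R) (f : V -> W)
    (df : {linear V -> W}) (x : V) : continuous df ->
  (forall eps : R, 0 < eps ->
    \forall v \near (0 : V), `|f (v + x) - f x - df v| <= eps * `|v|) ->
  differentiable f x.
Proof.
move=> cdf Hdf; have E : f \o shift x = cst (f x) + df +o_ 0 id.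
  apply/eqaddoP => eps /Hdf; apply: filterS => v.
  by rewrite !fctE/= opprD addrA.
have dE : 'd f x = df :> (V -> W) by exact: diff_unique.
by apply/diff_locallyP; rewrite dE.
Qed.

Section convex_differentiability.
Context {R : realType} {s : nat}.
Implicit Types (f : 'cV[R]_s -> R) (x v : 'cV[R]_s).

Lemma cV_sum_delta v : \sum_i v i 0 *: delta_mx i 0 = v.
Proof.
apply/colP => i; rewrite summxE (bigD1 i)//= !mxE !eqxx mulr1 big1 ?addr0// => j ji.
by rewrite !mxE eq_sym (negbTE ji) mulr0.
Qed.

(* A convex function whose one-variable restrictions to the coordinate lines are
   differentiable is Frechet differentiable: its remainder is convex, so it is
   bounded by the average of its values on the axes. *)
Lemma smooth_along_frechet f x : convex_fun f ->
  (forall i, smooth_along f x (delta_mx i 0)) ->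
  exists g : 'rV[R]_s, forall eps : R, 0 < eps -> exists2 delta : R, 0 < delta &
    forall v, `|v| <= delta -> `|f (x + v) - f x - (g *m v) 0 0| <= eps * `|v|.
Proof.
move=> cf sf; have [d Hd] := choice (fun i => smooth_along_derivative cf (sf i)).
pose g : 'rV[R]_s := \row_i d i; exists g.
pose r v := f (x + v) - f x - (g *m v) 0 0.
have r0 : r 0 = 0 by rewrite /r addr0 subrr mulmx0 mxE subr0.
have gD v w : (g *m (v + w)) 0 0 = (g *m v) 0 0 + (g *m w) 0 0.
  by rewrite mulmxDr mxE.
have gZ (a : R) v : (g *m (a *: v)) 0 0 = a * (g *m v) 0 0.
  by rewrite -scalemxAr mxE.
(* The remainder is convex, so its value at a sum is at most the mean of its values at the doubled
   summands; [rup] adds one axis at a time and pays for the doubling by halving radius and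
   tolerance. *)
have rD v w : r (v + w) <= 2^-1 * (r (2 *: v) + r (2 *: w)).
  have := cf (x + 2 *: v) (x + 2 *: w) 2^-1 ltac:(lra).
  rewrite (_ : 1 - 2^-1 = 2^-1 :> R); last by lra.
  have -> : 2^-1 *: (x + 2 *: v) + 2^-1 *: (x + 2 *: w) = x + (v + w).
    rewrite -scalerDr addrACA -mulr2n -[x *+ 2]scaler_nat -!scalerDr scalerA.
    by rewrite mulVf ?pnatr_eq0// scale1r.
  by rewrite /r gD !gZ; lra.
have rup (l : seq 'I_s) : forall eps : R, 0 < eps -> exists2 delta : R, 0 < delta &
    forall v, `|v| <= delta -> r (\sum_(i <- l) v i 0 *: delta_mx i 0) <= eps * `|v|.
  elim: l => [|i l IH] eps eps0.
    by exists 1 => // v _; rewrite big_nil r0 mulr_ge0// ltW.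
  have [d1 d10 H1] := IH (eps / 2) ltac:(lra).
  have [d2 d20 H2] := Hd i (eps / 2) ltac:(lra).
  exists (Num.min d1 d2 / 2) => [|v vd]; first by rewrite divr_gt0// lt_min d10.
  have {vd}v2d : `|2 *: v| <= Num.min d1 d2 by rewrite normrZ normr_nat; lra.
  move: v2d; rewrite le_min => /andP[v1 v2].
  rewrite big_cons addrC; apply: le_trans (rD _ _) _.
  have -> : 2 *: (\sum_(j <- l) v j 0 *: delta_mx j 0) =
      \sum_(j <- l) (2 *: v) j 0 *: delta_mx j 0 :> 'cV[R]_s.
    by rewrite scaler_sumr; apply: eq_bigr => j _; rewrite scalerA mxE.
  have v2i := ler_mx_norm_entry (2 *: v) i 0.
  have := H1 _ v1; have /= := H2 ((2 *: v) i 0) (le_trans v2i v2).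
  have -> : 2 *: (v i 0 *: delta_mx i 0) = (2 *: v) i 0 *: delta_mx i 0 :> 'cV[R]_s.
    by rewrite scalerA mxE.
  have -> : r ((2 *: v) i 0 *: delta_mx i 0) =
      f (x + (2 *: v) i 0 *: delta_mx i 0) - f x - (2 *: v) i 0 * d i.
    rewrite /r gZ; congr (_ - _ * _).
    rewrite mxE (bigD1 i)//= big1 ?addr0 => [|j ji].
      by rewrite !mxE !eqxx mulr1.
    by rewrite !mxE (negbTE ji) mulr0.
  move=> /(le_trans (ler_norm _)) H H'.
  have {}H := le_trans H (ler_wpM2l (ltW (_ : 0 < eps / 2)) v2i).
  have := H ltac:(lra); have -> : `|2 *: v| = 2 * `|v| by rewrite normrZ normr_nat.
  move: H'; have -> : `|2 *: v| = 2 * `|v| by rewrite normrZ normr_nat.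
  lra.
move=> eps eps0; have [delta d0 H] := rup (index_enum 'I_s) eps eps0.
exists delta => // v vd; rewrite -/(r v).
have := H v vd; rewrite cV_sum_delta => rv.
(* Lower bound: the remainders at [v] and [- v] add up to a nonnegative second difference. *)
have := H (- v); rewrite normrN => /(_ vd); rewrite cV_sum_delta => rNv.
rewrite ler_norml rv andbT.
have := convex_second_diff_ge0 x v cf; move: rNv.
rewrite /r /second_diff -scaleN1r gZ; lra.
Qed.

(** In the Frechet expansions at [v] and [- v] the linear terms cancel. *)
Lemma smooth_along_all f x : convex_fun f ->
  (forall i, smooth_along f x (delta_mx i 0)) -> forall v, smooth_along f x v.
Proof.
move=> cf /(smooth_along_frechet cf)[g Hg] v eps eps0.
have [v0|v0] := eqVneq v 0.
  by exists 1; rewrite ?ltr01// /second_diff v0 scaler0 addr0 subr0; lra.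
have nv : 0 < `|v| by rewrite normr_gt0.
have [|d d0 Hd] := Hg (eps / (2 * `|v|)); first by rewrite divr_gt0// mulr_gt0.
exists (d / `|v|) => [|]; first exact: divr_gt0.
have nd : `|(d / `|v|) *: v| = d.
  by rewrite normrZ ger0_norm ?divfK ?gt_eqF// divr_ge0// ltW.
have gN w : (g *m - w) 0 0 = - (g *m w) 0 0 by rewrite mulmxN mxE.
have := Hd ((d / `|v|) *: v); have := Hd (- ((d / `|v|) *: v)).
rewrite normrN nd gN => /(_ (lexx _)) + /(_ (lexx _)).
move=> /(le_trans (ler_norm _)) H1 /(le_trans (ler_norm _)) H2.
have -> : eps * (d / `|v|) = 2 * (eps / (2 * `|v|) * d) by field; rewrite gt_eqF.
by rewrite /second_diff; lra.
Qed.

Lemma lipschitz_mulmx_rV (g : 'rV[R]_s) v w :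
  `|(g *m v) 0 0 - (g *m w) 0 0| <= (\sum_j `|g 0 j|) * `|v - w|.
Proof.
have -> : (g *m v) 0 0 - (g *m w) 0 0 = (g *m (v - w)) 0 0.
  by rewrite mulmxBr [RHS]mxE; congr (_ + _); rewrite [RHS]mxE.
rewrite [in leLHS]mxE mulr_suml (le_trans (ler_norm_sum _ _ _))//.
by apply: ler_sum => j _; rewrite normrM ler_wpM2l// ler_mx_norm_entry.
Qed.

Lemma smooth_along_differentiable f x : convex_fun f ->
  (forall i, smooth_along f x (delta_mx i 0)) -> differentiable f x.
Proof.
move=> cf /(smooth_along_frechet cf)[g Hg].
have lg : linear (fun v => (g *m v) 0 0).
  by move=> a v w; rewrite mulmxDr -scalemxAr !mxE.
pose df : {linear 'cV[R]_s -> R} := HB.pack (fun v => (g *m v) 0 0)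
  (GRing.isLinear.Build _ _ _ _ _ lg).
have cdf : continuous df.
  apply: (@lipschitz_fun_continuous _ _ _ df (\sum_j `|g 0 j|)) => v w.
  by rewrite /df/=; exact: lipschitz_mulmx_rV.
apply: (@differentiable_eps _ _ _ f df) => // eps eps0.
have [d d0 Hd] := Hg eps eps0; near=> v; rewrite [v + x]addrC; apply: Hd.
rewrite -[v]subr0 -normrN opprB; near: v.
by apply/nbhs_ballP; exists d => //= v; rewrite -ball_normE => /ltW.
Unshelve. all: by end_near.
Qed.
End convex_differentiability.

(** [G] minus its chord attains a maximum on the unit interval. A positive second difference rules
    out an interior maximizer, and at the end points the difference is zero. *)
Lemma le_chord_of_local_strict_convexity (R : realType) (G : R -> R) :
  continuous G ->
  (forall t, 0 < t < 1 -> exists h, [/\ 0 < h, 0 <= t - h, t + h <= 1 &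
     0 < G (t + h) + G (t - h) - 2 * G t]) ->
  forall t, 0 <= t <= 1 -> G t <= t * G 1 + (1 - t) * G 0.
Proof.
move=> cG HG.
pose H t := G t - (t * G 1 + (1 - t) * G 0).
have cH : continuous H.
  by move=> t; apply: cvgB; [exact: cG|apply: cvgD; apply: cvgM => //;
    try exact: cvg_cst; apply: cvgB => //; exact: cvg_cst].
have [c] := @EVT_max R H 0 1 ler01 (continuous_subspaceT cH).
rewrite in_itv/= => /andP[c0 c1] Hc.
suff Hc0 : H c <= 0.
  move=> t t01; have := Hc t; rewrite in_itv/= => /(_ t01).
  by move=> /le_trans/(_ Hc0); rewrite /H subr_le0.
have [cE|cn0] := eqVneq c 0; first by rewrite cE /H; lra.
have [cE|cn1] := eqVneq c 1; first by rewrite cE /H; lra.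
have [|h [h0 ch0 ch1 HGc]] := HG c.
  by rewrite !lt_neqAle c0 c1 cn1 eq_sym cn0.
have := Hc (c + h); have := Hc (c - h); rewrite !in_itv/= ch0 ch1 !andbT.
move=> /(_ ltac:(lra)) H1 /(_ ltac:(lra)) H2.
by move: H1 H2 HGc; rewrite /H; lra.
Qed.

(** * Borel measurability and translation invariance of Lebesgue measure *)

Section borel_matrices.
Context {R : realType} {m n : nat}.

Lemma open_measurable_mx (U : set 'M[R]_(m, n)) : open U -> measurable U.
Proof. by move=> oU; exact: sub_sigma_algebra. Qed.

Lemma closed_measurable_mx (C : set 'M[R]_(m, n)) : closed C -> measurable C.
Proof.
by move=> cC; rewrite -[C]setCK; apply: measurableC; apply: open_measurable_mx;
  exact: closed_openC.
Qed.

Lemma continuous_measurable_mx (f : 'M[R]_(m, n) -> R) :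
  continuous f -> measurable_fun setT f.
Proof.
move=> cf; apply: (measurability _ (RGenOpens.measurableE R)).
move=> _ [U oU <-]; rewrite setTI; apply: open_measurable_mx.
apply: open_comp; first by move=> M _; exact: cf.
by case: oU => a [b ->]; exact: interval_open.
Qed.

Lemma measurable_shift_mx (v : 'M[R]_(m, n)) :
  measurable_fun setT (fun x : 'M[R]_(m, n) => x + v).
Proof.
apply: measurable_fun_mx => i j.
rewrite (_ : (fun t => _) = (fun t : 'M[R]_(m, n) => t i j + v i j)).
  by apply: measurable_funD => //; exact: measurable_mx_coord.
by apply/funext => t; rewrite mxE.
Qed.

End borel_matrices.

Section lebesgue_vec_translation.
Context {R : realType}.

Lemma lebesgue_measure_shift (a : R) (A : set (measurableTypeR R)) :
  measurable A ->
  pushforward lebesgue_measure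
    (fun x : measurableTypeR R => x + a : measurableTypeR R) A =
  lebesgue_measure A.
Proof.
move=> mA.
have ms : measurable_fun setT (fun x : measurableTypeR R => x + a : measurableTypeR R).
  by apply: measurable_funD.
apply/esym/lebesgue_measure_unique => //= _ [[b c]] _ <-.
rewrite /pushforward.
rewrite (_ : _ @^-1` _ = `](b - a), (c - a)]%classic).
  rewrite !lebesgue_measure_itv/= !lte_fin ltrD2r.
  by case: ifP => // _; rewrite -!EFinB; congr EFin; ring.
by apply/seteqP; split => x /=; rewrite !in_itv/= ltrBlDr lerBrDr.
Qed.

Lemma vec_consD n (p : measurableTypeR R * 'cV[R]_n) (v : 'cV[R]_n.+1) :
  vec_cons p + v =
  vec_cons ((p.1 + v ord0 0) : measurableTypeR R, p.2 + \col_i v (lift ord0 i) 0).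
Proof.
apply/colP => i; rewrite /vec_cons !mxE.
case: splitP => j ij; rewrite !mxE.
  by congr (_ + v _ _); apply/val_inj; rewrite /= ij ord1.
by congr (_ + v _ _); apply/val_inj; rewrite /= ij.
Qed.

(** Induction on the dimension: slicing along the first coordinate leaves translated slices, handled
    by the induction hypothesis, and a translation of the line. *)
Lemma lebesgue_vec_shift n (v : 'cV[R]_n) (A : set 'cV[R]_n) : measurable A ->
  lebesgue_vec R n ((fun x => x + v) @^-1` A) = lebesgue_vec R n A.
Proof.
elim: n v A => [|n IH] v A mA.
  congr (lebesgue_vec R 0 _); apply/seteqP.
  by split => x; rewrite /= (_ : x + v = x)//; apply/colP => -[].
pose B := @vec_cons R n @^-1` A.
have mB : measurable B.
  by rewrite /B -[_ @^-1` _]setTI; exact: (measurable_vec_cons measurableT mA).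
pose v' : 'cV[R]_n := \col_i v (lift ord0 i) 0.
transitivity (\int[lebesgue_measure]_(a in setT)
    lebesgue_vec R n (xsection B ((a : R) + v ord0 0)%R))%E.
  rewrite /= /leb_cons /pushforward /product_measure1; apply: eq_integral => a _ /=.
  rewrite -[RHS](IH v'); last exact: measurable_xsection.
  congr (lebesgue_vec R n _); apply/seteqP; split => w.
    by rewrite /xsection /= !inE/= vec_consD.
  by rewrite /xsection /= !inE/= vec_consD.
pose g (a : measurableTypeR R) := lebesgue_vec R n (xsection B a).
have mg : measurable_fun setT g.
  exact: measurable_fun_xsection.
have ms : measurable_fun setT
    (fun x : measurableTypeR R => x + v ord0 0 : measurableTypeR R).
  by apply: measurable_funD.
rewrite (_ : lebesgue_vec R n.+1 A = \int[lebesgue_measure]_a g a)%E//.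
rewrite -[LHS](@ge0_integral_pushforward _ _ _ _ _ _ ms lebesgue_measure setT g)//.
by apply: eq_measure_integral => E mE _; exact: lebesgue_measure_shift.
Qed.

Lemma ge0_integral_shift n (v : 'cV[R]_n) (f : 'cV[R]_n -> \bar R) :
  (forall x, 0 <= f x)%E -> measurable_fun setT f ->
  (\int[lebesgue_vec R n]_x f (x + v)%R = \int[lebesgue_vec R n]_x f x)%E.
Proof.
move=> f0 mf.
rewrite -[LHS](@ge0_integral_pushforward _ _ _ _ _ _ (measurable_shift_mx v)
  (lebesgue_vec R n) setT f)//.
apply: eq_measure_integral => [|mf' E mE _]; first exact: measurable_shift_mx.
exact: lebesgue_vec_shift.
Qed.

End lebesgue_vec_translation.

(** * Almost everywhere smoothness of convex functions *)

Definition lipschitz_with (R : realType) (V : normedModType R) (L : R) (f : V -> R) :=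
  forall x y, `|f x - f y| <= L * `|x - y|.

Lemma ler_mx_norm_all (R : realType) m n (M : 'M[R]_(m, n)) (a : R) : 0 <= a ->
  `|M| <= a <-> forall i j, `|M i j| <= a.
Proof.
move=> a0; split=> [Ma i j|H]; first exact: le_trans (ler_mx_norm_entry _ _ _) Ma.
by rewrite [leLHS]/Num.norm /= mx_normrE; apply/bigmax_leP; split.
Qed.

Lemma closed_sublevel (R : realType) (T : topologicalType) (g : T -> R) (a : R) :
  continuous g -> closed [set x | g x <= a].
Proof. by move=> /continuous_closedP/(_ _ (@closed_le R a)). Qed.

Lemma closed_superlevel (R : realType) (T : topologicalType) (g : T -> R) (a : R) :
  continuous g -> closed [set x | a <= g x].
Proof. by move=> /continuous_closedP/(_ _ (@closed_ge R a)). Qed.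

Lemma lipschitz_second_diff (R : realType) (V : normedModType R) (f : V -> R) v
    (L : R) : lipschitz_with L f -> lipschitz_with (4 * L) (second_diff f ^~ v).
Proof.
move=> fL x y.
have shiftL w : `|f (x + w) - f (y + w)| <= L * `|x - y|.
  by apply: le_trans (fL _ _) _; rewrite opprD addrACA subrr addr0.
have := shiftL v; have := shiftL (- v); have := fL x y.
rewrite /second_diff !ler_norml; lra.
Qed.

Section kinks.
Context {R : realType} {s : nat}.
Implicit Types (f : 'cV[R]_s -> R) (x v e c : 'cV[R]_s).
Local Notation leb := (lebesgue_vec R s).

(** The norm is the max norm, so this is a closed cube of half-side [a], whose volume is
    explicit. *)
Definition cbox c (a : R) : set 'cV[R]_s := [set x | `|x - c| <= a].

Lemma closed_cbox c a : closed (cbox c a).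
Proof.
apply: (@closed_sublevel _ _ (fun x : 'cV[R]_s => `|x - c|)).
apply: (@lipschitz_fun_continuous _ _ _ _ 1) => x y; rewrite mul1r.
by apply: le_trans (ler_dist_dist _ _) _; rewrite opprB addrA subrK.
Qed.

Lemma measurable_cbox c a : measurable (cbox c a).
Proof. by apply: closed_measurable_mx; exact: closed_cbox. Qed.

Lemma lebesgue_vec_cbox c a : 0 <= a -> leb (cbox c a) = ((2 * a) ^+ s)%:E.
Proof.
move=> a0; have := @lebesgue_vec_box R s (c - const_mx a) (c + const_mx a).
rewrite (_ : [set v : 'cV_s | _] = cbox c a).
  move=> ->; last by move=> i; rewrite !mxE; lra.
  rewrite (eq_bigr (fun=> 2 * a)) ?prodr_const ?card_ord// => i _.
  by rewrite !mxE; lra.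
apply/seteqP; split => x /=; rewrite /cbox/=.
  move=> H; apply/ler_mx_norm_all => // i j; have := H i.
  by rewrite (ord1 j) !mxE ler_norml; lra.
move=> /(ler_mx_norm_all _ a0) H i; have := H i 0.
by rewrite !mxE ler_norml; lra.
Qed.

(** By translation invariance each of the [N] shifted functions has the integral of [f]; bounded
    overlap of translates thus bounds an integral. *)
Lemma integral_translates_le (N : nat) (c_ : nat -> 'cV[R]_s)
    (f g : 'cV[R]_s -> \bar R) :
  (forall x, 0 <= f x)%E -> measurable_fun setT f ->
  (forall x, 0 <= g x)%E -> measurable_fun setT g ->
  (forall x, \sum_(j < N) f (x + c_ j)%R <= g x)%E ->
  (N%:R%:E * \int[leb]_x f x <= \int[leb]_x g x)%E.
Proof.
move=> f0 mf g0 mg fg.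
have mfs j : measurable_fun setT (fun x => f (x + c_ j)).
  exact: measurableT_comp mf (measurable_shift_mx _).
apply: (@le_trans _ _ (\int[leb]_x \sum_(j < N) f (x + c_ j)%R)%E); last first.
  apply: ge0_le_integral => //.
  - by move=> x _; apply: sume_ge0.
  - by apply: emeasurable_sum => j; exact: mfs.
rewrite ge0_integral_sum//.
rewrite (eq_bigr (fun=> \int[leb]_x f x))%E; last first.
  by move=> j _; rewrite ge0_integral_shift.
by rewrite sumr_const card_ord mule_natl.
Qed.

(* The increments of f over consecutive steps of length 1/N telescope. *)
Lemma sum_kinks_le f x e (L eps : R) (N : nat) : (0 < N)%N ->
  convex_fun f -> lipschitz_with L f -> 0 < eps ->
  \sum_(j < N) eps * (`[< forall h, 0 < h ->
      eps * h <= second_diff f (x + (j%:R / N%:R) *: e) (h *: e) >])%:R <= 2 * (L * `|e|).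
Proof.
move=> N0 cf fL eps0; set h : R := N%:R^-1.
have h0 : 0 < h by rewrite invr_gt0 ltr0n.
pose a j := f (x + (j%:R * h) *: e) - f (x + ((j%:R - 1) * h) *: e).
have aL j : `|a j| <= L * (h * `|e|).
  apply: le_trans (fL _ _) _; rewrite opprD addrACA subrr add0r -scalerBl.
  by rewrite -mulrBl opprB addrCA subrr addr0 mul1r normrZ gtr0_norm.
rewrite -(ler_pM2r h0) mulr_suml.
apply: (@le_trans _ _ (\sum_(0 <= j < N) (a j.+1 - a j))).
  rewrite big_mkord; apply: ler_sum => j _.
  have -> : a j.+1 - a j = second_diff f (x + (j%:R * h) *: e) (h *: e).
    have E1 : (j.+1%:R * h) *: e = (j%:R * h) *: e + h *: e.
      by rewrite -scalerDl -natr1 mulrDl mul1r.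
    have E2 : (j.+1%:R - 1) * h = j%:R * h by rewrite -natr1 addrK.
    have E3 : ((j%:R - 1) * h) *: e = (j%:R * h) *: e - h *: e.
      by rewrite mulrBl mul1r scalerBl.
    by rewrite /a E1 E2 E3 /second_diff !addrA; lra.
  case: asboolP => [/(_ h h0)|_]; first by rewrite mulr1.
  by rewrite mulr0 mul0r convex_second_diff_ge0.
rewrite telescope_sumr//; apply: le_trans (ler_norm _) _.
apply: le_trans (ler_normB _ _) _.
by have := aL N; have := aL 0%N; lra.
Qed.

(** The translates of [K] by multiples of [e / N] overlap at most [M] times, by the telescoping
    bound, and stay in one box. Hence [N] times the measure of [K] is bounded uniformly in [N]. *)
Lemma lebesgue_vec_kinks_eq0 f e (L eps a : R) :
  convex_fun f -> lipschitz_with L f -> 0 < eps -> 0 <= a ->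
  let K := [set x | `|x| <= a /\ forall h, 0 < h -> eps * h <= second_diff f x (h *: e)] in
  measurable K /\ leb K = 0%E.
Proof.
move=> cf fL eps0 a0 K.
have cK : closed K.
  rewrite (_ : K = cbox 0 a `&` \bigcap_(h in [set h : R | 0 < h])
      [set x | eps * h <= second_diff f x (h *: e)]); last first.
    by apply/seteqP; split=> x [/=]; rewrite /cbox/= subr0.
  apply: closedI; first exact: closed_cbox.
  apply: closed_bigI => h h0.
  apply: (@closed_superlevel _ _ (fun x => second_diff f x (h *: e))).
  exact: (lipschitz_fun_continuous (lipschitz_second_diff _ fL)).
have mK := closed_measurable_mx cK; split => //.
have Kfin : (leb K < +oo)%E.
  apply: (@le_lt_trans _ _ (leb (cbox 0 a))).
    apply: le_measure; rewrite ?inE//; first exact: measurable_cbox.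
    by move=> x [xa _]; rewrite /cbox/= subr0.
  by rewrite lebesgue_vec_cbox// ltry.
have fK : leb K \is a fin_num by rewrite ge0_fin_numE.
(* [M] is the bound of [sum_kinks_le] divided by [eps]; the radius [b] absorbs shifts of norm at
   most [|e|]. *)
pose M := 2 * (L * `|e|) / eps; pose b := a + `|e|.
have b0 : 0 <= b by rewrite addr_ge0.
have NK (N : nat) : (0 < N)%N -> N%:R * fine (leb K) <= M * (2 * b) ^+ s.
  move=> N0.
  have M0 : 0 <= M.
    apply: divr_ge0; last exact: ltW.
    by rewrite mulr_ge0// -[e]subr0; exact: le_trans (fL e 0).
  rewrite -lee_fin EFinM fineK//.
  have mb : measurable_fun setT (fun x => (\1_(cbox 0 b) x : R)%:E).
    by apply/measurable_EFinP/measurable_indic; exact: measurable_cbox.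
  have KE : (\int[leb]_x (\1_K x)%:E = leb K)%E by rewrite integral_indic// setIT.
  have bE : (\int[leb]_x (M * \1_(cbox 0 b) x)%:E = (M * (2 * b) ^+ s)%:E)%E.
    under eq_integral do rewrite EFinM.
    rewrite ge0_integralZl//.
    rewrite integral_indic ?setIT//; last exact: measurable_cbox.
    by rewrite [RHS]EFinM; congr (_ * _)%E; exact: lebesgue_vec_cbox.
  rewrite -KE -bE.
  apply: (@integral_translates_le N (fun j => (j%:R / N%:R) *: e)).
  - by move=> x; rewrite lee_fin.
  - exact/measurable_EFinP/measurable_indic.
  - by move=> x; rewrite lee_fin mulr_ge0.
  - by apply/measurable_EFinP/measurable_funM => //; apply/measurable_EFinP.
  move=> x; rewrite sumEFin lee_fin.
  have [xb|xb] := pselect (cbox 0 b x).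
    rewrite [X in _ <= M * X]indicE mem_set// mulr1 ler_pdivlMr// mulrC mulr_sumr.
    apply: le_trans (sum_kinks_le x e N0 cf fL eps0); apply: ler_sum => j _.
    apply: ler_wpM2l (ltW eps0) _ _ _; rewrite indicE ler_nat.
    case: asboolP; first by move=> _; exact: leq_b1.
    by move=> nk; rewrite memNset// => -[_].
  rewrite big1; first by apply: mulr_ge0.
  move=> j _; rewrite indicE memNset// => -[xa _].
  apply: xb; rewrite /cbox/= subr0 /b.
  rewrite -[x](addrK ((j%:R / N%:R) *: e)) (le_trans (ler_normB _ _))// lerD//.
  rewrite normrZ ger0_norm ?divr_ge0// ler_piMl//.
  by rewrite ler_pdivrMr ?ltr0n// mul1r ler_nat ltnW.
apply/eqP; rewrite -(fineK fK) eqe eq_le fine_ge0// andbT.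
rewrite leNgt; apply/negP => K0.
have := NK (Num.truncn (M * (2 * b) ^+ s / fine (leb K))).+1 isT.
by rewrite -ler_pdivlMr// leNgt truncnS_gt.
Qed.

(** A point without smoothness carries a kink of some positive size, so the exceptional set lies in
    a countable union of null sets. *)
Lemma convex_ae_smooth_along f e (L : R) : convex_fun f -> lipschitz_with L f ->
  {ae leb, forall x, smooth_along f x e}.
Proof.
move=> cf fL.
pose K (k : nat) := [set x : 'cV[R]_s | `|x| <= k%:R /\
  forall h, 0 < h -> k.+1%:R^-1 * h <= second_diff f x (h *: e)].
apply: (@negligibleS _ _ _ _ (\bigcup_k K k)); last first.
  apply: negligible_bigcup => k.
  have [] := @lebesgue_vec_kinks_eq0 f e L k.+1%:R^-1 k%:R cf fL; rewrite ?invr_gt0//.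
  by move=> mK K0; exact/negligibleP.
move=> x; rewrite /= /smooth_along => /existsNP[eps] /not_implyP[eps0 nh].
(* [n] bounds [|x|] and [k] bounds [eps^-1]; the index [n + k] serves both purposes. *)
pose n := (Num.truncn `|x|).+1; pose k := (Num.truncn eps^-1).+1.
exists (n + k)%N => //; split.
  by rewrite (le_trans (ltW (truncnS_gt _)))// ler_nat leq_addr.
move=> h h0; rewrite leNgt; apply/negP => hn; apply: nh; exists h => //.
rewrite (le_trans (ltW hn))// ler_pM2r// -[leRHS]invrK lef_pV2 ?posrE ?invr_gt0//.
by rewrite (le_trans (ltW (truncnS_gt _)))// ler_nat; exact: leqW (leq_addl _ _).
Qed.

End kinks.

(** * The value function of a linear program *)

Section compactness.
Context {R : realType} {s : nat}.

(** Heine-Borel is applied to row vectors and carried over by transposition, an isometry for the max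
    norm. *)
Lemma compact_cbox (c : 'cV[R]_s) (a : R) : compact (cbox c a).
Proof.
have ctr : continuous (@trmx R 1 s).
  apply: (@lipschitz_fun_continuous _ _ _ _ 1) => M N; rewrite mul1r -linearB.
  by apply/ler_mx_norm_all => // i j; rewrite mxE ler_mx_norm_entry.
pose A := [set M : 'rV[R]_s | `|M - c^T| <= a].
have [a0|a0] := leP 0 a; last first.
  rewrite (_ : cbox c a = set0); first exact: compact0.
  apply/seteqP; split=> // x /= xa; have := le_trans (normr_ge0 _) xa.
  by rewrite leNgt a0.
rewrite (_ : cbox c a = trmx @` A).
  apply: continuous_compact; first exact: continuous_subspaceT.
  apply: bounded_closed_compact.
    exists (a + `|c^T|); split; first exact: num_real.
    move=> x xa M /= MA; apply: ltW; apply: le_lt_trans xa.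
    by rewrite -[M](subrK c^T); apply: le_trans (ler_normD _ _) _; rewrite lerD2r.
  apply: (@closed_sublevel _ _ (fun x : 'rV[R]_s => `|x - c^T|)).
  apply: (@lipschitz_fun_continuous _ _ _ _ 1) => x y; rewrite mul1r.
  by apply: le_trans (ler_dist_dist _ _) _; rewrite opprB addrA subrK.
have tr x : cbox c a x <-> A x^T.
  rewrite /A/= -linearB; split => /(ler_mx_norm_all _ a0) H;
  by apply/(ler_mx_norm_all _ a0) => i j; have := H j i; rewrite ?mxE.
apply/seteqP; split => [x xc|_ [M MA <-]].
  by exists x^T; rewrite ?trmxK//; apply/tr.
by apply/tr; rewrite trmxK.

Qed.

End compactness.

Section sublinear.
Context {R : realType} {s : nat}.
Implicit Types (f : 'cV[R]_s -> R) (t u : 'cV[R]_s).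

Definition sublinear f :=
  (forall t u, f (t + u) <= f t + f u) /\
  (forall (a : R) t, 0 <= a -> f (a *: t) = a * f t).

Lemma sublinear_convex f : sublinear f -> convex_fun f.
Proof.
move=> [fD fZ] t u a /andP[a0 a1]; apply: le_trans (fD _ _) _.
by rewrite !fZ// subr_ge0.
Qed.

(** Subadditivity reduces [f t] to values on the axes, which gives [f t <= L * |t|]; then
    [f t - f u <= f (t - u)]. *)
Lemma sublinear_lipschitz f : sublinear f -> exists L : R, lipschitz_with L f.
Proof.
move=> [fD fZ].
have f0 : f 0 = 0 by rewrite -(scale0r 0) fZ// mul0r.
pose e (i : 'I_s) : 'cV[R]_s := delta_mx i 0.
pose L := \sum_i (`|f (e i)| + `|f (- e i)|).
have fL t : f t <= L * `|t|.
  rewrite -[in leLHS](cV_sum_delta t) mulr_suml.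
  apply: (@le_trans _ _ (\sum_i f (t i 0 *: e i))).
    elim/big_ind2 : _ => [|x x' y y' xx yy|//]; first by rewrite f0.
    by apply: le_trans (fD _ _) _; exact: lerD.
  apply: ler_sum => i _.
  apply: (@le_trans _ _ ((`|f (e i)| + `|f (- e i)|) * `|t i 0|)); last first.
    by rewrite ler_wpM2l ?addr_ge0// ler_mx_norm_entry.
  have [t0|t0] := leP 0 (t i 0).
    by rewrite (ger0_norm t0) fZ// mulrC ler_wpM2r// (le_trans (ler_norm _))// lerDl.
  have t0' : 0 <= - t i 0 by rewrite oppr_ge0 ltW.
  rewrite -[_ *: _]opprK -scaleNr -scalerN fZ//.
  by rewrite (ltr0_norm t0) mulrC ler_wpM2r// (le_trans (ler_norm _))// lerDr.
exists L => t u; rewrite ler_norml; apply/andP; split.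
  have := fD t (u - t); rewrite addrC subrK => H.
  have := fL (u - t); rewrite distrC; lra.
by have := fD u (t - u); rewrite addrC subrK; have := fL (t - u); lra.
Qed.

End sublinear.

Section linear_program.
Context {R : realType} {s m : nat}.
Variables (W : 'M[R]_(s, m)) (q : 'cV[R]_m).
Hypothesis A1 : forall t : 'cV[R]_s, exists y : 'cV[R]_m,
  (forall j, 0 <= y j 0) /\ W *m y = t.
Hypothesis A2 : exists xi : 'cV[R]_s, forall j, (W^T *m xi) j 0 < q j 0.
Local Notation phi := (lp_value W q).

Definition feasible (t : 'cV[R]_s) : set 'cV[R]_m :=
  [set y | W *m y = t /\ forall j, 0 <= y j 0].

Definition cost (y : 'cV[R]_m) : R := (q^T *m y) 0 0.

(* Adding W^T xi to the cost changes it by a constant on the feasible set, so it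
   may be assumed strictly positive. *)
Lemma reduced_cost : exists2 p : 'I_m -> R, (forall j, 0 < p j) &
  exists xi : 'cV[R]_s, forall t y, feasible t y ->
    cost y = (xi^T *m t) 0 0 + \sum_j p j * y j 0.
Proof.
have [xi Hxi] := A2.
exists (fun j => q j 0 - (W^T *m xi) j 0) => [j|]; first by rewrite subr_gt0.
exists xi => t y [<- _].
rewrite /cost mulmxA -[xi^T *m W]trmxK trmx_mul trmxK !mxE -big_split/=.
by apply: eq_bigr => j _; rewrite mxE [X in _ = X * _ + _]mxE; ring.
Qed.

Lemma lp_value_attained t : exists2 y, feasible t y &
  phi t = cost y /\ forall y', feasible t y' -> cost y <= cost y'.
Proof.
suff [y ty miny] : exists2 y, feasible t y & forall y', feasible t y' -> cost y <= cost y'.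
  exists y => //; split => //.
  pose S := [set (q^T *m y) 0 0 | y in feasible t].
  have Sy : (S `&` lbound S) (cost y).
    by split; [exists y|move=> _ [y' ty' <-]; exact: miny].
  rewrite /lp_value /set_min -/(feasible t) -/S.
  (* [S] has a least element, so [xget] does not return its default. *)
  case: xgetP => [_ -> [[y' ty' <-] lb]|/(_ (cost y))//].
  apply/eqP; rewrite eq_le; apply/andP; split; last exact: miny.
  by apply: lb; exists y.
have [y0 [y00 Wy0]] := A1 t.
have [p p0 [xi Hp]] := reduced_cost.
pose B := cost y0 - (xi^T *m t) 0 0; pose M := \sum_j B / p j.
pose K := feasible t `&` [set y | cost y <= cost y0].
have KM : K `<=` cbox 0 M.
  move=> y [ty /= yy0]; rewrite /cbox/= subr0.
  have py_ge0 j : 0 <= p j * y j 0 by apply: mulr_ge0; [exact: ltW|case: ty].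
  have pB : \sum_j p j * y j 0 <= B by rewrite /B; have := Hp _ _ ty; lra.
  have B0 : 0 <= B by apply: le_trans pB; apply: sumr_ge0.
  have Bp j : 0 <= B / p j by rewrite divr_ge0// ltW.
  apply/ler_mx_norm_all; first exact: sumr_ge0.
  move=> i j; rewrite (ord1 j) ger0_norm; last by case: ty.
  rewrite /M (bigD1 i)//= ler_wpDr ?sumr_ge0// ler_pdivlMr// mulrC.
  by apply: le_trans pB; rewrite (bigD1 i)//= lerDl sumr_ge0.
have lin_cont k (g : 'rV[R]_k) : continuous (fun v : 'cV[R]_k => (g *m v) 0 0).
  exact: lipschitz_fun_continuous (lipschitz_mulmx_rV g).
have cK : compact K.
  apply: (subclosed_compact _ (@compact_cbox _ _ 0 M) KM).
  rewrite (_ : K = \bigcap_(i in [set: 'I_s])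
      ([set y | (row i W *m y) 0 0 <= t i 0] `&`
       [set y | t i 0 <= (row i W *m y) 0 0]) `&`
    \bigcap_(j in [set: 'I_m]) [set y | 0 <= ((delta_mx 0 j : 'rV[R]_m) *m y) 0 0] `&`
    [set y | cost y <= cost y0]).
    apply: closedI; last by apply: closed_sublevel; exact: lin_cont.
    apply: closedI; apply: closed_bigI => i _.
      by apply: closedI; [apply: closed_sublevel|apply: closed_superlevel];
        exact: lin_cont.
    by apply: closed_superlevel; exact: lin_cont.
  rewrite /K /feasible; congr (_ `&` _); apply/seteqP; split => y /=.
    move=> [Wy y_ge0]; split=> i _ /=; last by rewrite -rowE mxE.
    by rewrite -row_mul mxE Wy.
  move=> [Wy y_ge0]; split=> [|j]; last by have := y_ge0 j I; rewrite /= -rowE mxE.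
  apply/colP => i; apply/eqP; have [] := Wy i I.
  by rewrite /= -row_mul mxE eq_le => -> ->.
have Ky0 : K y0 by split; [split|rewrite /=].
have [|y] := compact_EVT_min (ex_intro _ y0 Ky0) cK (f := cost).
  by apply: continuous_subspaceT; exact: lin_cont.
rewrite inE => -[ty yy0] miny; exists y => // y' ty'.
have [yy|/ltW yy] := leP (cost y') (cost y0); last exact: le_trans yy0 yy.
by apply: miny; rewrite inE.
Qed.

Lemma lp_value_le t y : feasible t y -> phi t <= cost y.
Proof. by have [y0 _ [-> miny]] := lp_value_attained t; exact: miny. Qed.

Lemma costD y y' : cost (y + y') = cost y + cost y'.
Proof. by rewrite /cost mulmxDr mxE. Qed.

Lemma costZ (a : R) y : cost (a *: y) = a * cost y.
Proof. by rewrite /cost -scalemxAr mxE. Qed.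

Lemma lp_value_sublinear : sublinear phi.
Proof.
split=> [t u|a t a0].
  have [y [ty y0] [-> _]] := lp_value_attained t.
  have [z [uz z0] [-> _]] := lp_value_attained u.
  rewrite -costD; apply: lp_value_le; split=> [|j]; first by rewrite mulmxDr ty uz.
  by rewrite mxE addr_ge0.
have leZ b v : 0 <= b -> phi (b *: v) <= b * phi v.
  move=> b0; have [y [vy y0] [-> _]] := lp_value_attained v.
  rewrite -costZ; apply: lp_value_le; split=> [|j]; first by rewrite -scalemxAr vy.
  by rewrite mxE mulr_ge0.
apply/eqP; rewrite eq_le leZ//=.
(* For [a = 0], scaling by 2 yields [phi 0 <= 2 * phi 0], hence [0 <= phi 0]; for [a > 0] the
   inequality [leZ] is applied to the inverse scalar. *)
have [<-|an0] := eqVneq 0 a.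
  rewrite mul0r scale0r; have := leZ 2 0 ltac:(lra).
  by rewrite scaler0; lra.
have a_gt0 : 0 < a by rewrite lt_neqAle an0.
have := leZ a^-1 (a *: t); rewrite invr_ge0 => /(_ a0).
by rewrite scalerA mulVf ?gt_eqF// scale1r mulrC ler_pdivlMr// mulrC.
Qed.

(** In [phi t + phi (- t)] the linear terms in [xi] cancel and only positive combinations of
    feasible entries remain. Such a combination controls [|t|], because [t = W y] and [w j]
    dominates the entries in column [j] of [W]. *)
Lemma lp_value_coercive : exists2 c : R, 0 < c &
  forall t, c * `|t| <= phi t + phi (- t).
Proof.
have [p p0 [xi Hp]] := reduced_cost.
pose w j := 1 + \sum_i `|W i j|.
have w0 j : 0 < w j by rewrite ltr_pwDl// sumr_ge0.
have wp j : 0 <= w j / p j by apply: divr_ge0; exact: ltW.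
pose d := 1 + \sum_j w j / p j.
have d0 : 0 < d by rewrite ltr_pwDl// sumr_ge0.
exists d^-1 => [|t]; first by rewrite invr_gt0.
have [y ty [-> _]] := lp_value_attained t.
have [z tz [-> _]] := lp_value_attained (- t).
have xiN : (xi^T *m (- t)) 0 0 = - (xi^T *m t) 0 0 by rewrite mulmxN mxE.
rewrite (Hp _ _ ty) (Hp _ _ tz) xiN.
have [Wy y0] := ty; have [_ z0] := tz.
have pz : 0 <= \sum_j p j * z j 0.
  by apply: sumr_ge0 => j _; apply: mulr_ge0 => //; exact: ltW.
suff : d^-1 * `|t| <= \sum_j p j * y j 0 by lra.
rewrite mulrC ler_pdivrMr//.
have wp_le j : w j <= p j * d.
  rewrite mulrC -ler_pdivrMr// /d (bigD1 j)//= addrCA lerDl addr_ge0//.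
  by rewrite sumr_ge0.
apply: (@le_trans _ _ (\sum_j w j * y j 0)); last first.
  by rewrite mulr_suml; apply: ler_sum => j _; rewrite mulrAC ler_wpM2r.
apply/ler_mx_norm_all => [|i j].
  by apply: sumr_ge0 => j _; rewrite mulr_ge0// ltW.
rewrite (ord1 j) -Wy mxE (le_trans (ler_norm_sum _ _ _))//.
apply: ler_sum => k _; rewrite normrM (ger0_norm (y0 k)) ler_wpM2r//.
by rewrite /w (bigD1 i)//= addrCA lerDl addr_ge0// sumr_ge0.
Qed.

End linear_program.

(** * Integrated curvature of a sublinear function *)

(** Once the last index satisfies [P], indices at least [K] steps before it fail, and at most [K]
    are left. *)
Lemma sum_window_le (P : pred nat) (K N : nat) :
  (forall i j, P i -> P j -> (i < j)%N -> (j - i < K)%N) -> (0 < K)%N ->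
  (\sum_(j < N) P j <= K)%N.
Proof.
move=> HP K0; rewrite -(big_mkord predT (fun j => P j : nat)).
elim: N => [|N IH]; first by rewrite big_geq.
have [PN|nPN] := boolP (P N); last by rewrite big_nat_recr//= (negbTE nPN) addn0.
rewrite (big_cat_nat (n := N.+1 - K)) ?leq_subr//=.
rewrite big_nat big1 ?add0n => [|j /andP[_ jN]]; last first.
  apply/eqP; rewrite eqb0; apply/negP => Pj.
  have := HP j N Pj PN; lia.
apply: (@leq_trans (\sum_(N.+1 - K <= j < N.+1) 1)).
  by apply: leq_sum => j _; exact: leq_b1.
by rewrite sum_nat_const_nat muln1; lia.
Qed.

Section sublinear_curvature.
Context {R : realType} {s : nat}.
Variables (f : 'cV[R]_s -> R) (L c : R).
Hypotheses (sf : sublinear f) (fL : lipschitz_with L f) (L0 : 0 < L) (c0 : 0 < c)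
  (fc : forall t, c * `|t| <= f t + f (- t)).
Local Notation leb := (lebesgue_vec R s).

(** The sum telescopes to the outer slope at [a + N v] minus the one at [a - N v]. Convexity
    compares these with the mean slopes between [a] and each end, which gives at least
    [c * |v| - 4 * L * |a| / N]; the hypothesis on [a] keeps half of [c * |v|]. *)
Lemma sum_second_diff_ge (a v : 'cV[R]_s) (N : nat) : (0 < N)%N ->
  8 * L * `|a| <= c * (N%:R * `|v|) ->
  c * `|v| / 2 <= \sum_(j < N + N.+1) second_diff f (a + (j%:R - N%:R) *: v) v.
Proof.
move=> N0 aN; have cf := sublinear_convex sf.
have N_gt0 : 0 < N%:R :> R by rewrite ltr0n.
pose D j := f (a + (j%:R - N%:R) *: v) - f (a + (j%:R - N%:R - 1) *: v).
rewrite (eq_bigr (fun j : 'I_(N + N.+1) => D j.+1 - D j)); last first.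
  move=> j _; rewrite /second_diff /D.
  have E1 : (j.+1%:R - N%:R) *: v = (j%:R - N%:R) *: v + v.
    by rewrite -natr1 addrAC scalerDl scale1r.
  have E2 : j.+1%:R - N%:R - 1 = j%:R - N%:R :> R by rewrite -natr1; ring.
  by rewrite E1 E2 [(_ - 1) *: v]scalerBl scale1r !addrA; lra.
rewrite -(big_mkord predT (fun j => D j.+1 - D j)) telescope_sumr// /D.
have -> : (N + N.+1)%:R - N%:R = N%:R + 1 :> R by rewrite natrD -natr1; ring.
rewrite addrK sub0r.
have := convex_slope (a + N%:R *: v) v cf ltr01 N_gt0.
have := convex_slope (a - N%:R *: v) (- v) cf ltr01 N_gt0.
rewrite !divr1 !scale1r scalerN opprK subrK addrK.
rewrite -[a - _ - v]addrA -opprD -[a + _ + v]addrA.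
have -> : N%:R *: v + v = (N%:R + 1) *: v by rewrite scalerDl scale1r.
have -> : (- N%:R) *: v = - (N%:R *: v) by rewrite scaleNr.
have -> : (- N%:R - 1) *: v = - ((N%:R + 1) *: v) by rewrite -opprD scaleNr.
rewrite !ler_pdivrMr//.
have := fc (N%:R *: v); rewrite normrZ normr_nat.
have := fL (a + N%:R *: v) (N%:R *: v); rewrite addrK.
have := fL (a - N%:R *: v) (- (N%:R *: v)); rewrite opprK subrK.
have := fL a 0; rewrite subr0.
have f0 : f 0 = 0 by rewrite -(scale0r 0) sf.2// mul0r.
rewrite f0 subr0 !ler_norml => /andP[_ h1] /andP[h2 _] /andP[h3 _] h4 h5 h6.
rewrite -(ler_pM2r N_gt0); nra.
Qed.

(* Summing the kinks of f over the translates of a small box by multiples of v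
   telescopes to the total change of slope, while each point is covered by only
   O(1/|v|) translates. *)
Lemma integral_second_diff_ge (delta : R) : 0 < delta ->
  exists kappa eta : R, [/\ 0 < kappa, 0 < eta & forall v, `|v| <= eta ->
    ((kappa * `|v| ^+ 2)%:E <=
      \int[leb]_(w in cbox 0%R delta) (second_diff f w v)%:E)%E].
Proof.
move=> delta0; have cf := sublinear_convex sf.
(* Shifts have norm at most [T] and the small box has radius at most [T / 2], so all translates stay
   in the box of radius [delta]. The second bound on [eps] meets the hypothesis of
   [sum_second_diff_ge]. *)
pose T := delta / 2; have T0 : 0 < T by rewrite divr_gt0.
pose eps := Num.min (T / 2) (c * T / (16 * L)).
have eps0 : 0 < eps by rewrite lt_min !divr_gt0// ?mulr_gt0.
have epsT : eps <= T / 2 by rewrite ge_min lexx.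
have epsL : 16 * L * eps <= c * T.
  by rewrite mulrC -ler_pdivlMr ?mulr_gt0// ge_min lexx orbT.
(* [kappa] is the bound [c * |v| / 2 * (2 * eps) ^+ s] of [lower] divided by the multiplicity
   [M = 3 * eps / |v|] and by [|v| ^+ 2]. *)
exists ((2 * eps) ^+ s * c / (6 * eps)), eps; split => //.
  by rewrite divr_gt0 ?mulr_gt0// exprn_gt0// mulr_gt0.
move=> v vL; have sd0 w : 0 <= second_diff f w v by exact: convex_second_diff_ge0.
have [->|vn0] := eqVneq v 0.
  rewrite normr0 expr0n/= mulr0; apply: integral_ge0 => w _.
  by rewrite lee_fin; exact: convex_second_diff_ge0.
have v0 : 0 < `|v| by rewrite normr_gt0.
(* [N] is the largest number with [N * |v| <= T]; as [|v| <= T / 2], also [T / 2 <= N * |v|]. *)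
pose N := Num.truncn (T / `|v|).
have NT : N%:R * `|v| <= T /\ T < (N%:R + 1) * `|v|.
  have := @truncn_itv _ (T / `|v|) (divr_ge0 (ltW T0) (ltW v0)).
  by rewrite -/N ler_pdivlMr// ltr_pdivrMr// -natr1 => /andP[].
have N0 : (0 < N)%N by rewrite -(ltr_nat R); nra.
pose A := cbox (0 : 'cV[R]_s) eps; pose B := cbox (0 : 'cV[R]_s) delta.
have mA : measurable A by exact: measurable_cbox.
have mB : measurable B by exact: measurable_cbox.
pose c_ (j : nat) : 'cV[R]_s := (j%:R - N%:R) *: v.
have c_le j : (j < N + N.+1)%N -> `|c_ j| <= T.
  move=> jN; rewrite normrZ; apply: le_trans NT.1; rewrite ler_pM2r// ler_norml.
  have : j%:R <= (N + N)%:R :> R by rewrite ler_nat; lia.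
  by rewrite natrD; have := ler0n R j; lra.
pose F j (w : 'cV[R]_s) : \bar R := (\1_A (w - c_ j) * second_diff f w v)%:E.
have msd : measurable_fun setT (fun w => second_diff f w v).
  apply: continuous_measurable_mx.
  exact: (lipschitz_fun_continuous (lipschitz_second_diff _ fL)).
have mF j : measurable_fun setT (F j).
  apply/measurable_EFinP/measurable_funM => //.
  exact: (measurableT_comp (measurable_indic mA) (measurable_shift_mx _)).
have F0 j w : (0 <= F j w)%E by rewrite lee_fin mulr_ge0.
pose M := 3 * eps / `|v|.
have lower : ((c * `|v| / 2 * (2 * eps) ^+ s)%:E <=
    \sum_(j < N + N.+1) \int[leb]_w F j w)%E.
  rewrite [leRHS](eq_bigr (fun j : 'I_(N + N.+1) => \int[leb]_x F j (x + c_ j)%R)%E).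
    2: by move=> j _; rewrite ge0_integral_shift.
  rewrite -ge0_integral_sum//; last first.
    by move=> j; exact: measurableT_comp (mF j) (measurable_shift_mx _).
  have AE : (\int[leb]_x (c * `|v| / 2 * \1_A x)%:E =
      (c * `|v| / 2 * (2 * eps) ^+ s)%:E)%E.
    have cv0 : 0 <= c * `|v| / 2 by rewrite divr_ge0// mulr_ge0 ?ltW.
    under eq_integral do rewrite EFinM.
    rewrite ge0_integralZl//; last exact/measurable_EFinP/measurable_indic.
    rewrite integral_indic ?setIT// [RHS]EFinM; congr (_ * _)%E.
    by apply: lebesgue_vec_cbox; exact: ltW.
  rewrite -AE; apply: ge0_le_integral => //.
  - by move=> x _; rewrite lee_fin mulr_ge0// divr_ge0// mulr_ge0 ?ltW.
  - by apply/measurable_EFinP/measurable_funM => //; exact: measurable_indic.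
  - apply: emeasurable_sum => j.
    exact: measurableT_comp (mF j) (measurable_shift_mx _).
  move=> x _; rewrite sumEFin lee_fin.
  have [xA|xA] := pselect (A x); last first.
    by rewrite indicE memNset// mulr0; apply: sumr_ge0 => j _; rewrite mulr_ge0.
  rewrite indicE mem_set// mulr1.
  rewrite (eq_bigr (fun j : 'I_(N + N.+1) => second_diff f (x + c_ j) v)); last first.
    by move=> j _; rewrite addrK indicE mem_set// mul1r.
  apply: sum_second_diff_ge => //.
  have xeps : `|x| <= eps by move: xA; rewrite /A/cbox/= subr0.
  have h1 : T / 2 <= N%:R * `|v| by case: NT; lra.
  have h2 : L * `|x| <= L * eps by rewrite ler_pM2l.
  have h3 : c * (T / 2) <= c * (N%:R * `|v|) by rewrite ler_pM2l.
  by lra.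
have upper : (\sum_(j < N + N.+1) \int[leb]_w F j w <=
    M%:E * \int[leb]_(w in B) (second_diff f w v)%:E)%E.
  have M0 : 0 <= M by rewrite divr_ge0 ?mulr_ge0 ?ltW.
  have mBsd : measurable_fun setT (fun w => (\1_B w : R) * second_diff f w v).
    by apply: measurable_funM => //; exact: measurable_indic.
  rewrite -ge0_integral_sum//.
  have BE : (\int[leb]_w (M * (\1_B w * second_diff f w v))%:E =
      M%:E * \int[leb]_(w in B) (second_diff f w v)%:E)%E.
    under eq_integral do rewrite EFinM.
    rewrite ge0_integralZl//; last 2 first.
    - exact/measurable_EFinP.
    - by move=> w _; rewrite lee_fin mulr_ge0.
    congr (_ * _)%E; rewrite [RHS]integral_mkcond; apply: eq_integral => w _.
    by rewrite patchE indicE; case: ifPn; rewrite ?mul1r ?mul0r.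
  rewrite -BE; apply: ge0_le_integral => //.
  - by move=> w _; apply: sume_ge0.
  - exact: emeasurable_sum.
  - by apply/measurable_EFinP; exact: (measurable_funM (measurable_cst M) mBsd).
  move=> w _; rewrite sumEFin lee_fin.
  have [wB|wB] := pselect (B w); last first.
    rewrite [X in _ <= _ * (X * _)]indicE memNset// mul0r mulr0 big1// => j _.
    rewrite indicE memNset ?mul0r// /A/cbox/= subr0 => wc; apply: wB.
    rewrite /B/cbox/= subr0 -[w](subrK (c_ j)) (le_trans (ler_normD _ _))//.
    by have := c_le j (ltn_ord j); move: epsT wc; rewrite /T; lra.
  rewrite [X in _ <= _ * (X * _)]indicE mem_set// mul1r -mulr_suml ler_wpM2r//.
  pose P (j : nat) := (w - c_ j) \in A.
  rewrite (eq_bigr (fun j : 'I_(N + N.+1) => (P j)%:R)); last first.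
    by move=> j _; rewrite indicE.
  rewrite -natr_sum.
  (* Two translates covering [w] have indices at most [2 * eps / |v|] apart, and [|v| <= eps] bounds
     the resulting count by [M]. *)
  apply: (@le_trans _ _ (Num.truncn (2 * eps / `|v|)).+1%:R).
    rewrite ler_nat; apply: sum_window_le => // i j.
    rewrite !inE /A/cbox/= !subr0 => Pi Pj ij.
    rewrite -(ltr_nat R); apply: le_lt_trans (truncnS_gt _).
    rewrite ler_pdivlMr// -[(j - i)%:R]ger0_norm// -normrZ.
    have -> : (j - i)%:R *: v = (w - c_ i) - (w - c_ j).
      rewrite natrB; last exact: ltnW.
      by rewrite opprB [RHS]addrC [RHS]addrA subrK -scalerBl; congr (_ *: _); ring.
    by apply: le_trans (ler_normB _ _) _; lra.
  have := @truncn_itv _ (2 * eps / `|v|) (divr_ge0 _ (ltW v0)).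
  rewrite -natr1 => /(_ ltac:(lra))/andP[+ _].
  rewrite /M !ler_pdivlMr//; lra.
have M0 : 0 < M by rewrite divr_gt0// mulr_gt0.
have := le_trans lower upper; rewrite -lee_pdivrMl// -EFinM; apply: le_trans.
rewrite lee_fin le_eqVlt; apply/orP; left; apply/eqP.
by rewrite /M; field; rewrite !gt_eqF.
Qed.
End sublinear_curvature.

(** * Integrals of convex Lipschitz families *)

Section enorm_comparison.
Context {R : realType} {s : nat}.
Implicit Types z : 'cV[R]_s.

Lemma enorm_ge0 z : 0 <= enorm z.
Proof. exact: sqrtr_ge0. Qed.

Lemma sqr_enorm z : enorm z ^+ 2 = \sum_i z i 0 ^+ 2.
Proof. by rewrite sqr_sqrtr// sumr_ge0// => i _; exact: sqr_ge0. Qed.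

Lemma ler_norm_enorm z : `|z| <= enorm z.
Proof.
apply/ler_mx_norm_all => [|i j]; first exact: enorm_ge0.
rewrite (ord1 j) -sqrtr_sqr ler_wsqrtr// (bigD1 i)//= lerDl.
by apply: sumr_ge0 => k _; exact: sqr_ge0.
Qed.

Lemma sqr_enorm_le z : enorm z ^+ 2 <= s%:R * `|z| ^+ 2.
Proof.
rewrite sqr_enorm mulr_natl -[X in _ *+ X]card_ord -sumr_const.
by apply: ler_sum => i _; rewrite -real_normK ?num_real// lerXn2r ?nnegrE//
  ler_mx_norm_entry.
Qed.

Lemma measurable_enorm : measurable_fun setT (@enorm R s).
Proof.
apply: (measurableT_comp (f := @Num.sqrt R)).
  by apply: continuous_measurable_fun; exact: sqrt_continuous.
apply: measurable_sum => i; apply: measurable_funX.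
exact: measurable_mx_coord.
Qed.

End enorm_comparison.

Section lipschitz_closure.
Context {R : realType} {V : normedModType R}.
Implicit Types (f g : V -> R) (L : R).

Lemma lipschitz_withW f L L' : L <= L' -> lipschitz_with L f -> lipschitz_with L' f.
Proof. by move=> LL fL x y; apply: le_trans (fL _ _) _; rewrite ler_wpM2r. Qed.

Lemma lipschitz_cst (a : R) : lipschitz_with 0 (fun _ : V => a).
Proof. by move=> x y; rewrite subrr normr0 mul0r. Qed.

Lemma lipschitz_max f g L : lipschitz_with L f -> lipschitz_with L g ->
  lipschitz_with L (fun x => Num.max (f x) (g x)).
Proof.
move=> fL gL x y; have := fL x y; have := gL x y; rewrite !ler_norml.
by case: (leP (f x)); case: (leP (f y)); lra.
Qed.

Lemma lipschitz_min f g L : lipschitz_with L f -> lipschitz_with L g ->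
  lipschitz_with L (fun x => Num.min (f x) (g x)).
Proof.
move=> fL gL x y; have := fL x y; have := gL x y; rewrite !ler_norml.
by case: (leP (f x)); case: (leP (f y)); lra.
Qed.

Lemma lipschitz_sub f L (z : V) : lipschitz_with L f ->
  lipschitz_with L (fun x => f (z - x)).
Proof.
move=> fL x y; apply: le_trans (fL _ _) _.
by rewrite opprB addrC addrA subrK distrC.
Qed.

Lemma lipschitz_shift f L (x : V) : lipschitz_with L f ->
  lipschitz_with L (fun z => f (z - x)).
Proof.
by move=> fL y z; apply: le_trans (fL _ _) _; rewrite opprB addrA subrK.
Qed.

Lemma convex_max f g : convex_fun f -> convex_fun g ->
  convex_fun (fun x => Num.max (f x) (g x)).
Proof.
move=> cf cg x y t t01; have [t0 t1] : 0 <= t /\ 0 <= 1 - t by lra.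
by rewrite ge_max; apply/andP; split;
  [apply: le_trans (cf _ _ _ t01) _|apply: le_trans (cg _ _ _ t01) _];
  apply: lerD; apply: ler_wpM2l => //; rewrite le_max lexx ?orbT.
Qed.

Lemma convex_cst (a : R) : convex_fun (fun _ : V => a).
Proof. by move=> x y t _; lra. Qed.

Lemma convex_sub f (z : V) : convex_fun f -> convex_fun (fun x => f (z - x)).
Proof.
move=> cf x y t t01; apply: le_trans (cf _ _ _ t01); rewrite le_eqVlt.
apply/orP; left; apply/eqP; congr (f _).
by rewrite !scalerBr addrACA -opprD -scalerDl [t + (1 - t)]addrC subrK scale1r.
Qed.

Lemma second_diff_sub f (z x v : V) :
  second_diff (fun y => f (z - y)) x v = second_diff f (z - x) v.
Proof. by rewrite /second_diff !opprD opprK !addrA; congr (_ - _); rewrite [LHS]addrC. Qed.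

Lemma second_diff_le_small f (x e : V) (eps h h' : R) : convex_fun f -> 0 < h ->
  second_diff f x (h *: e) <= eps * h -> 0 <= h' <= h ->
  second_diff f x (h' *: e) <= eps * h'.
Proof.
move=> cf h0 Hh /andP[h'0 h'h].
have -> : h' *: e = (h' / h) *: (h *: e) by rewrite scalerA divfK ?gt_eqF.
apply: le_trans (convex_second_diff_scale _ _ cf _) _.
  by apply/andP; split; [apply: divr_ge0 => //; exact: ltW|rewrite ler_pdivrMr// mul1r].
apply: le_trans (ler_wpM2l _ Hh) _; first by apply: divr_ge0 => //; exact: ltW.
by rewrite mulrCA divfK ?gt_eqF.
Qed.

Lemma lipschitz_second_diff_le f (x v : V) L : lipschitz_with L f ->
  second_diff f x v <= 2 * L * `|v|.
Proof.
move=> fL; have := fL (x + v) x; have := fL (x - v) x.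
have addxK w : x + w - x = w by rewrite addrC addKr.
by rewrite !addxK normrN !ler_norml /second_diff; lra.
Qed.

(** Where the values differ, Lipschitz continuity keeps the larger function on top along a short
    segment through [x], and the maximum inherits its smoothness. *)
Lemma smooth_along_max f g (x e : V) L : convex_fun f -> convex_fun g ->
  lipschitz_with L f -> lipschitz_with L g -> smooth_along f x e ->
  smooth_along g x e -> f x != g x ->
  smooth_along (fun y => Num.max (f y) (g y)) x e.
Proof.
have main f1 g1 : convex_fun g1 -> lipschitz_with L f1 -> lipschitz_with L g1 ->
    smooth_along g1 x e -> f1 x < g1 x ->
    smooth_along (fun y => Num.max (f1 y) (g1 y)) x e.
  move=> cg fL gL sg fg eps eps0; have [h h0 Hh] := sg eps eps0.
  have Le : 0 <= L * `|e| by rewrite -[e]subr0; exact: le_trans (fL e 0).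
  pose d := (g1 x - f1 x) / (2 * (L * `|e|) + 1).
  have d0 : 0 < d by rewrite divr_gt0 ?subr_gt0// ltr_wpDl// mulr_ge0.
  exists (Num.min h d) => [|]; first by rewrite lt_min h0.
  set k := Num.min h d; have k0 : 0 < k by rewrite lt_min h0.
  have kd : 2 * (L * (k * `|e|)) <= g1 x - f1 x.
    have : k * (2 * (L * `|e|) + 1) <= g1 x - f1 x.
      rewrite -ler_pdivlMr; last by lra.
      by rewrite /k ge_min lexx orbT.
    by nra.
  have mE w : `|w| <= k * `|e| -> Num.max (f1 (x + w)) (g1 (x + w)) = g1 (x + w).
    move=> wk; apply/max_idPr; have := fL (x + w) x; have := gL (x + w) x.
    have Lw : L * `|w| <= L * (k * `|e|).
      have [L0|L0] := leP 0 L; first by rewrite ler_wpM2l.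
      (* A negative [L] is compatible with [Le] only if [e], hence [w], is zero. *)
      have e0 : `|e| = 0 by have := normr_ge0 e; nra.
      by move: wk; rewrite e0 !mulr0 normr_le0 => /eqP ->; rewrite normr0 mulr0.
    rewrite addrAC subrr add0r !ler_norml; lra.
  have ke : `|k *: e| = k * `|e| by rewrite normrZ gtr0_norm.
  rewrite /second_diff mE ?ke// mE ?normrN ?ke//.
  have -> : Num.max (f1 x) (g1 x) = g1 x by apply/max_idPr; exact: ltW.
  apply: (second_diff_le_small cg h0 Hh); rewrite (ltW k0)/=.
  by rewrite ge_min lexx.
move=> cf cg fL gL sf sg; rewrite neq_lt => /orP[fg|fg]; first exact: main.
rewrite (_ : (fun y => _) = fun y => Num.max (g y) (f y)); first exact: main.
by apply/funext => y; rewrite maxC.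
Qed.

End lipschitz_closure.

Section lipschitz_integrals.
Context {R : realType} {s : nat}.
Variable mu : probability 'cV[R]_s R.
Hypothesis A3 : (\int[mu]_z (enorm z)%:E < +oo)%E.

Lemma lipschitz_measurable (g : 'cV[R]_s -> R) (L : R) :
  lipschitz_with L g -> measurable_fun setT g.
Proof.
by move=> gL; apply: continuous_measurable_mx; exact: lipschitz_fun_continuous gL.
Qed.

(** Domination by [|g 0| + |L| * enorm z], which the finite first moment makes integrable. *)
Lemma lipschitz_integrable (g : 'cV[R]_s -> R) (L : R) :
  lipschitz_with L g -> mu.-integrable setT (EFin \o g).
Proof.
move=> gL; have mg := lipschitz_measurable gL.
have ie : mu.-integrable setT (fun z => (enorm z)%:E).
  apply/integrableP; split; first by apply/measurable_EFinP; exact: measurable_enorm.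
  rewrite (eq_integral (fun z => (enorm z)%:E))//.
  by move=> z _; rewrite /= ger0_norm// enorm_ge0.
have ib : mu.-integrable setT (fun z => (`|g 0| + `|L| * enorm z)%:E).
  rewrite (_ : (fun _ => _) = (cst `|g 0|%:E \+ (fun z => `|L|%:E * (enorm z)%:E)))%E//.
  apply: integrableD => //; last exact: integrableZl.
  exact: finite_measure_integrable_cst.
apply: le_integrable ib => //; first exact/measurable_EFinP.
move=> z _ /=; rewrite lee_fin [leRHS]ger0_norm ?addr_ge0 ?mulr_ge0 ?enorm_ge0//.
have := gL z 0; rewrite subr0 => H.
rewrite -[g z](subrK (g 0)) addrC (le_trans (ler_normD _ _))// lerD2l.
apply: le_trans H _; apply: (@le_trans _ _ (`|L| * `|z|)).
  by rewrite ler_wpM2r// ler_norm.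
by rewrite ler_wpM2l// ler_norm_enorm.
Qed.

Section parametrized.
Variables (G : 'cV[R]_s -> 'cV[R]_s -> R) (L : R).
Hypotheses (iG : forall x, mu.-integrable setT (EFin \o G x))
  (cG : forall z, convex_fun (G ^~ z)) (GL : forall z, lipschitz_with L (G ^~ z)).
Let F x := \int[mu]_z G x z.

Lemma integrableRZ (g : 'cV[R]_s -> R) (a : R) : mu.-integrable setT (EFin \o g) ->
  mu.-integrable setT (EFin \o (fun z => a * g z)).
Proof.
move=> ig; rewrite (_ : EFin \o _ = (fun z => a%:E * (EFin \o g) z)%E)//.
exact: integrableZl.
Qed.

Lemma integrableRD (g h : 'cV[R]_s -> R) : mu.-integrable setT (EFin \o g) ->
  mu.-integrable setT (EFin \o h) ->
  mu.-integrable setT (EFin \o (fun z => g z + h z)).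
Proof.
move=> ig ih; rewrite (_ : EFin \o _ = ((EFin \o g) \+ (EFin \o h)))%E//.
exact: integrableD.
Qed.

Lemma integrable_second_diff x v :
  mu.-integrable setT (EFin \o (fun z => second_diff (G ^~ z) x v)).
Proof.
rewrite (_ : (fun z => _) = fun z => G (x + v) z + G (x - v) z + - 2 * G x z).
  by apply: integrableRD; [exact: integrableRD|exact: integrableRZ].
by apply/funext => z; rewrite /second_diff mulNr.
Qed.

Lemma second_diff_integral x v :
  second_diff F x v = \int[mu]_z second_diff (G ^~ z) x v.
Proof.
rewrite /second_diff RintegralB//; [|exact: integrableRD|exact: integrableRZ].
by rewrite RintegralD// RintegralZl.
Qed.

Lemma convex_integral : convex_fun F.
Proof.
move=> x y t t01; rewrite /F -!RintegralZl// -RintegralD//; try exact: integrableRZ.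
apply: le_Rintegral => //; first by apply: integrableRD; exact: integrableRZ.
by move=> z _; exact: cG.
Qed.

Lemma lipschitz_integral : lipschitz_with L F.
Proof.
have dF x y : F x - F y <= L * `|x - y|.
  rewrite -RintegralB//; apply: (@le_trans _ _ (\int[mu]_z (L * `|x - y|))).
    apply: le_Rintegral => //.
    - rewrite (_ : EFin \o _ = EFin \o (fun z => G x z + -1 * G y z)).
        by apply: integrableRD => //; exact: integrableRZ.
      by apply/funext => z /=; rewrite mulN1r.
    - exact: finite_measure_integrable_cst.
    - by move=> z _; apply: le_trans (ler_norm _) (GL z x y).
  rewrite Rintegral_cst//; have mu1 : fine (mu setT) = 1 by rewrite probability_setT.
  by rewrite -[leRHS]mulr1 -mu1.
by move=> x y; rewrite ler_norml dF andbT lerNl opprB distrC dF.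
Qed.

(** The second difference quotients with steps [1 / (n + 1)] are nonnegative, bounded by
    [2 * L * |e|] and tend to zero almost everywhere, so dominated convergence applies. *)
Lemma smooth_along_integral x e : {ae mu, forall z, smooth_along (G ^~ z) x e} ->
  smooth_along F x e.
Proof.
move=> aeG eps eps0.
pose h (n : nat) : R := n.+1%:R^-1; have h0 n : 0 < h n by rewrite invr_gt0.
pose d n z := n.+1%:R * second_diff (G ^~ z) x (h n *: e).
have d0 n z : 0 <= d n z by rewrite mulr_ge0// convex_second_diff_ge0.
have id_ n : mu.-integrable setT (EFin \o d n).
  by apply: integrableRZ; exact: integrable_second_diff.
have dL n z : d n z <= 2 * L * `|e|.
  apply: le_trans (ler_wpM2l (ler0n _ _) (lipschitz_second_diff_le _ _ (GL z))) _.
  rewrite normrZ (gtr0_norm (h0 n)).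
  have -> : n.+1%:R * (2 * L * (h n * `|e|)) = n.+1%:R * h n * (2 * L * `|e|) by ring.
  by rewrite mulfV ?mul1r.
have [] := @dominated_convergence _ _ _ mu setT measurableT
  (fun n => EFin \o d n) (cst 0%E) (cst (2 * L * `|e|)%:E).
- by move=> n; have /integrableP[] := id_ n.
- exact: measurable_cst.
- move: aeG; apply: filterS => z sz _.
  suff dz : d n z @[n --> \oo] --> (0 : R).
    by apply: cvg_EFin => //; exact: nearW.
  apply/cvgrPdist_le => eps' eps'0; have [k k0 Hk] := sz eps' eps'0.
  (* By convexity a single good step [k] controls the quotients of all smaller steps. *)
  exists (Num.truncn k^-1) => // n /= kn; rewrite sub0r normrN ger0_norm//.
  rewrite /d mulrC -ler_pdivlMr//; apply: (second_diff_le_small (cG z) k0 Hk).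
  rewrite (ltW (h0 n))/= -[k]invrK lef_pV2 ?posrE ?invr_gt0//.
  by rewrite (le_trans (ltW (truncnS_gt _)))// ler_nat.
- exact: finite_measure_integrable_cst.
- by apply: aeW => z n _; rewrite /= lee_fin ger0_norm.
move=> _ _; rewrite integral0 => d_cvg.
have {d_cvg} : \int[mu]_z d n z @[n --> \oo] --> (0 : R).
  by have /fine_cvg := d_cvg.
move=> /cvgrPdist_le/(_ _ eps0)[n _ /(_ n (leqnn n))].
rewrite sub0r normrN => /(le_trans (ler_norm _)) dn.
exists (h n) => //; rewrite second_diff_integral -ler_pdivrMr//.
apply: le_trans dn; rewrite invrK RintegralZl//; last exact: integrable_second_diff.
by rewrite mulrC.
Qed.

End parametrized.
End lipschitz_integrals.

(** * Measures with a density: null sets and lower bounds *)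

Section absolute_continuity.
Context {R : realType} {s : nat}.
Variables (mu : probability 'cV[R]_s R) (theta : 'cV[R]_s -> R).
Hypothesis A4_density : is_density theta mu.
Local Notation leb := (lebesgue_vec R s).

Lemma ae_density (P : 'cV[R]_s -> Prop) :
  {ae leb, forall z, P z} -> {ae mu, forall z, P z}.
Proof.
move=> [N [mN N0 PN]]; exists N; split => //.
have [mtheta _ ->//] := A4_density.
apply: null_set_integral => //; apply/measurable_EFinP.
exact: measurable_funTS.
Qed.

Lemma ae_lebesgue_vec_shift (P : 'cV[R]_s -> Prop) (x : 'cV[R]_s) :
  {ae leb, forall z, P z} -> {ae leb, forall z, P (z - x)}.
Proof.
move=> [N [mN N0 PN]]; exists ((fun z => z - x) @^-1` N); split.
- rewrite -[X in measurable X]setTI.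
  exact: (measurable_shift_mx (- x) measurableT mN).
- by rewrite lebesgue_vec_shift.
- by move=> z nPz; apply: PN.
Qed.

Lemma ae_forall_ord (k : nat) (P : 'I_k -> 'cV[R]_s -> Prop) :
  (forall i, {ae mu, forall z, P i z}) -> {ae mu, forall z, forall i, P i z}.
Proof.
move=> aeP.
have : {ae mu, forall z, forall n, if insub n is Some i then P i z else True}.
  apply/ae_foralln => n; case: insubP => [i _ _|_]; first exact: aeP.
  exact: aeW.
by apply: filterS => z Hz i; have := Hz i; rewrite valK.
Qed.

(** On measurable sets [mu] dominates [r] times Lebesgue measure restricted to [B]; integrating [k]
    against the two measures gives the bound. *)
Lemma density_integral_ge (r : R) (B : set 'cV[R]_s) (k : 'cV[R]_s -> \bar R) :
  0 < r -> measurable B -> {ae leb, forall z, B z -> r <= theta z} ->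
  (forall z, 0 <= k z)%E -> measurable_fun setT k ->
  (r%:E * \int[leb]_(z in B) k z <= \int[mu]_z k z)%E.
Proof.
move=> r0 mB rB k0 mk; have [mtheta theta0 muE] := A4_density.
pose rr : {nonneg R} := NngNum (ltW r0).
pose m1 := mscale rr (mrestr leb mB).
have m1_le S : measurable S -> (m1 S <= mu S)%E.
  move=> mS; rewrite /m1 /mscale /= /mrestr muE//.
  have mSB : measurable (S `&` B) by exact: measurableI.
  have mth : measurable_fun setT (EFin \o theta) by exact/measurable_EFinP.
  apply: (@le_trans _ _ (\int[leb]_(z in S `&` B) (theta z)%:E)%E).
    rewrite -integral_cst//; apply: ae_ge0_le_integral => //.
    - by move=> z _; rewrite lee_fin ltW.
    - by move=> z _; rewrite lee_fin.
    - exact: measurable_funTS.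
    - by move: rB; apply: filterS => z Hz [_ Bz]; rewrite lee_fin; exact: Hz.
  apply: ge0_subset_integral => //; first exact: measurable_funTS.
  by move=> z _; rewrite lee_fin.
apply: (@le_trans _ _ (\int[m1]_(z in B) k z)%E).
  rewrite ge0_integral_mscale//; last exact: measurable_funTS.
  rewrite lee_pmul2l//= [leRHS](eq_measure_integral leb)// => S mS SB.
  by rewrite /= /mrestr setIidl.
apply: (@le_trans _ _ (\int[mu]_(z in B) k z)%E); first exact: ge0_le_measure_integral.
exact: ge0_subset_integral.
Qed.

End absolute_continuity.

(** * Differentiability of the expected maximum *)

Section expected_value.
Context {R : realType} {s : nat}.
Variables (mu : probability 'cV[R]_s R) (theta : 'cV[R]_s -> R).
Hypothesis A3 : (\int[mu]_z (enorm z)%:E < +oo)%E.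
Hypothesis A4_density : is_density theta mu.
Variables (f : 'cV[R]_s -> R) (L : R).
Hypotheses (sf : sublinear f) (L0 : 0 < L) (fL : lipschitz_with L f).
Hypothesis A5 : forall x : 'cV[R]_s, mu [set z | f (z - x) = 0] = 0%E.
Local Notation leb := (lebesgue_vec R s).
Implicit Types (x y z e v : 'cV[R]_s).

Let cf : convex_fun f := sublinear_convex sf.

Lemma ae_smooth_along_sub (g : 'cV[R]_s -> R) (K : R) x e :
  convex_fun g -> lipschitz_with K g ->
  {ae mu, forall z, smooth_along (fun y => g (z - y)) x e}.
Proof.
move=> cg gK; apply: (ae_density A4_density).
have := ae_lebesgue_vec_shift x (convex_ae_smooth_along e cg gK).
apply: filterS => z sz eps eps0; have [h h0 Hh] := sz eps eps0.
by exists h => //; rewrite second_diff_sub.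
Qed.

(* A nonzero level set of f lies in the kinks of max(f, a): along the ray through
   t this maximum passes from the constant a to the linear function f. *)
Lemma ae_neq_level (a : R) x : {ae mu, forall z, f (z - x) != a}.
Proof.
(* The zero level set is null by (A5); it is closed, hence measurable. *)
have [->|a0] := eqVneq a 0.
  exists [set z | f (z - x) = 0]; split => //.
    apply: closed_measurable_mx; rewrite (_ : mkset _ =
      [set z | f (z - x) <= 0] `&` [set z | 0 <= f (z - x)]).
      have cfx : continuous (fun z => f (z - x)).
        exact: lipschitz_fun_continuous (lipschitz_shift x fL).
      by apply: closedI; [exact: closed_sublevel|exact: closed_superlevel].
    apply/seteqP; split => z /=; first by move=> ->.
    by move=> [? ?]; apply/eqP; rewrite eq_le; apply/andP.
  by move=> z /= /negP; rewrite negbK => /eqP.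
pose g t := Num.max (f t) a.
have cg : convex_fun g by apply: convex_max => //; exact: convex_cst.
have gL : lipschitz_with L g.
  apply: lipschitz_max => //; apply: lipschitz_withW (lipschitz_cst a); exact: ltW.
have := ae_forall_ord (fun i => @ae_smooth_along_sub g L x (delta_mx i 0) cg gL).
apply: filterS => z sz; apply/eqP => fa; pose t := z - x.
have /(smooth_along_all cg)/(_ t) : forall i, smooth_along g t (delta_mx i 0).
  move=> i eps eps0; have [h h0 Hh] := sz i eps eps0.
  by exists h => //; rewrite -second_diff_sub.
move=> /(_ (`|a| / 2)) [|h h0]; first by rewrite divr_gt0// normr_gt0.
(* [k <= 1] keeps [1 + k] and [1 - k] nonnegative, so homogeneity applies. The second difference of
   [g] along the ray is then [k * |a|], above the [k * |a| / 2] that smoothness allows. *)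
pose k := Num.min h 1; have k0 : 0 < k by rewrite lt_min h0 ltr01.
have k1 : k <= 1 by rewrite ge_min lexx orbT.
have kh : k <= h by rewrite ge_min lexx.
move=> /(second_diff_le_small cg h0)/(_ (_ : 0 <= k <= h)).
rewrite (ltW k0) kh => /(_ isT); apply/negP; rewrite -ltNge.
have fD b : 0 <= 1 + b -> g (t + b *: t) = Num.max ((1 + b) * a) a.
  by move=> b0; rewrite /g -[X in X + _]scale1r -scalerDl sf.2// fa.
rewrite /second_diff -scaleNr !fD; try lra.
rewrite /g fa maxxx.
have [a1|a1] := leP 0 a.
  rewrite ger0_norm// [Num.max (_ * _) _]max_l; last by nra.
  rewrite [Num.max (_ * _) _]max_r; last by nra.
  have : 0 < a by rewrite lt_neqAle eq_sym a0. nra.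
rewrite ltr0_norm// [Num.max (_ * _) _]max_r; last by nra.
rewrite [Num.max (_ * _) _]max_l; last by nra.
nra.
Qed.

(** For [f = lp_value W q] this and the next function unfold to [QE] and [QDplus]; [f] enters only
    through sublinearity, a Lipschitz bound, coercivity and null zero sets. *)
Definition expected x : R := \int[mu]_z f (z - x).
Definition expected_max x : R := \int[mu]_z Num.max (expected x) (f (z - x)).

Lemma integrable_sub x : mu.-integrable setT (EFin \o (fun z => f (z - x))).
Proof. exact: (lipschitz_integrable A3 (lipschitz_shift x fL)). Qed.

Lemma convex_expected : convex_fun expected.
Proof. by apply: convex_integral => [|z]; [exact: integrable_sub|exact: convex_sub]. Qed.

Lemma lipschitz_expected : lipschitz_with L expected.
Proof.
by apply: lipschitz_integral => [|z]; [exact: integrable_sub|exact: lipschitz_sub].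
Qed.

Lemma smooth_along_expected x e : smooth_along expected x e.
Proof.
apply: (smooth_along_integral integrable_sub (L := L)).
- by move=> z; exact: convex_sub.
- by move=> z; exact: lipschitz_sub.
- exact: ae_smooth_along_sub fL.
Qed.

Lemma integrable_max x :
  mu.-integrable setT (EFin \o (fun z => Num.max (expected x) (f (z - x)))).
Proof.
apply: (lipschitz_integrable A3 (L := L)); apply: lipschitz_max.
  by apply: lipschitz_withW (lipschitz_cst _); exact: ltW.
exact: lipschitz_shift.
Qed.

Lemma convex_max_sub z : convex_fun (fun x => Num.max (expected x) (f (z - x))).
Proof. by apply: convex_max; [exact: convex_expected|exact: convex_sub]. Qed.

(** For almost every [z] both branches of the maximum are smooth at [x] and differ there, since
    level sets of [f] are null; smoothness along the axes then passes through the integral. *)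
Lemma expected_max_differentiable x : differentiable expected_max x.
Proof.
apply: smooth_along_differentiable.
  by apply: convex_integral => [|z]; [exact: integrable_max|exact: convex_max_sub].
move=> i; apply: (smooth_along_integral integrable_max (L := L)).
- exact: convex_max_sub.
- by move=> z; apply: lipschitz_max; [exact: lipschitz_expected|exact: lipschitz_sub].
have := ae_smooth_along_sub x (delta_mx i 0) cf fL.
have := ae_neq_level (expected x) x; apply: filterS2 => z fz sz.
apply: (smooth_along_max (L := L)) => //.
- exact: convex_expected.
- exact: convex_sub.
- exact: lipschitz_expected.
- exact: lipschitz_sub.
- exact: smooth_along_expected.
- by rewrite eq_sym.
Qed.

End expected_value.

(** * Strong convexity of the expected maximum *)

Section strong_convexity.
Context {R : realType} {s : nat}.
Variables (mu : probability 'cV[R]_s R) (theta : 'cV[R]_s -> R).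
Hypothesis A3 : (\int[mu]_z (enorm z)%:E < +oo)%E.
Hypothesis A4_density : is_density theta mu.
Variables (f : 'cV[R]_s -> R) (L c : R).
Hypotheses (sf : sublinear f) (L0 : 0 < L) (fL : lipschitz_with L f)
  (c0 : 0 < c) (fc : forall t, c * `|t| <= f t + f (- t)).
Hypothesis A5 : forall x : 'cV[R]_s, mu [set z | f (z - x) = 0] = 0%E.
Variables (V : set 'cV[R]_s) (r rho : R).
Hypotheses (A4_convex : convex_set V) (A4_r : 0 < r) (A4_rho : 0 < rho).
Hypothesis A4_bound : {ae lebesgue_vec R s, forall z,
      [set v + b | v in V & b in eball rho] z -> r <= theta z}.
Local Notation leb := (lebesgue_vec R s).
Local Notation Q := (expected mu f).
Local Notation F := (expected_max mu f).
Implicit Types (x y z e v : 'cV[R]_s).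

Let cf : convex_fun f := sublinear_convex sf.
(** The divisor [s + 1] makes the max-norm box of radius [delta] fit in the open Euclidean ball of
    radius [rho], in every dimension including zero. *)
Let delta : R := rho / s.+1%:R.

Let delta0 : 0 < delta. Proof. by rewrite divr_gt0. Qed.

Lemma Rintegral_indicT (S : set 'cV[R]_s) : measurable S ->
  \int[mu]_z \1_S z = fine (mu S).
Proof. by move=> mS; rewrite /Rintegral integral_indic// setIT. Qed.

Lemma ae_cbox_density x : V x -> {ae leb, forall z, cbox x delta z -> r <= theta z}.
Proof.
move=> Vx; move: A4_bound; apply: filterS => z Hz xz; apply: Hz.
exists x => //; exists (z - x); last by rewrite addrC subrK.
rewrite /eball/= -(ltr_pXn2r (n := 2)) ?nnegrE ?enorm_ge0 ?ltW//.
apply: le_lt_trans (sqr_enorm_le _) _.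
apply: (@le_lt_trans _ _ (s%:R * delta ^+ 2)).
  by rewrite ler_wpM2l// lerXn2r ?nnegrE//; exact: ltW.
rewrite /delta expr_div_n mulrCA gtr_pMr ?exprn_gt0//.
rewrite ltr_pdivrMr ?exprn_gt0// mul1r -natrX ltr_nat; nia.
Qed.

(** The second difference of [Q] is the integral of those of [f], which are nonnegative; keeping
    only a box around [x], where the density is at least [r], leaves the Lebesgue estimate. *)
Lemma expected_second_diff_ge : exists kappa eta : R, [/\ 0 < kappa, 0 < eta &
  forall x v, V x -> `|v| <= eta -> kappa * `|v| ^+ 2 <= second_diff Q x v].
Proof.
have [k [eta [k0 eta0 H]]] := integral_second_diff_ge sf fL L0 c0 fc delta0.
exists (r * k), eta; split => // [|x v Vx veta]; first exact: mulr_gt0.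
have sd_ge0 w : 0 <= second_diff f w v by exact: convex_second_diff_ge0.
have mg : measurable_fun setT (fun w => (second_diff f w v)%:E).
  by apply/measurable_EFinP; exact: lipschitz_measurable (lipschitz_second_diff v fL).
have mgx : measurable_fun setT (fun z => (second_diff f (z - x) v)%:E).
  exact: (measurableT_comp mg (measurable_shift_mx (- x))).
have -> : second_diff Q x v = \int[mu]_z second_diff f (z - x) v.
  rewrite second_diff_integral; last exact: (integrable_sub A3 fL).
  by apply: eq_Rintegral => z _; rewrite second_diff_sub.
rewrite -lee_fin /Rintegral fineK; last first.
  apply: integrable_fin_num => //.
  exact: (lipschitz_integrable A3 (lipschitz_shift x (lipschitz_second_diff v fL))).
apply: le_trans (density_integral_ge A4_density A4_r (measurable_cbox x delta)
  (ae_cbox_density Vx) _ mgx); last by move=> z; rewrite lee_fin.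
rewrite -mulrA EFinM lee_pmul2l//.
apply: le_trans (H v veta) _; rewrite le_eqVlt; apply/orP; left; apply/eqP.
rewrite integral_mkcond [RHS]integral_mkcond.
rewrite -(ge0_integral_shift (- x)); first last.
- apply: (measurable_restrictT (fun w => (second_diff f w v)%:E) (measurable_cbox 0 delta)).1.
  exact: measurable_funTS.
- by move=> w; rewrite patchE; case: ifPn => // _; rewrite lee_fin.
apply: eq_integral => z _; rewrite !patchE.
by rewrite (_ : (z - x \in cbox 0 delta) = (z \in cbox x delta))//
  /cbox; apply/idP/idP; rewrite !inE /= subr0.
Qed.

Lemma convex_set_ray x u (t : R) : V x -> V (x + u) -> 0 <= t <= 1 ->
  V (x + t *: u).
Proof.
move=> Vx Vxu /andP[t0 t1]; pose l : {i01 R} := Itv01 t0 t1.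
have := A4_convex l (mem_set Vxu) (mem_set Vx).
rewrite inE /conv /= => Vl; rewrite (_ : x + t *: u = t *: (x + u) + (1 - t) *: x)//.
by rewrite scalerDr addrAC -scalerDl addrCA subrr addr0 scale1r.
Qed.

(** The curvature bound holds for short increments only; after subtraction of a quadratic,
    [le_chord_of_local_strict_convexity] makes it global along a segment in [V]. *)
Lemma expected_strongly_convex : exists2 K : R, 0 < K &
  forall x u (t : R), V x -> V (x + u) -> 0 <= t <= 1 ->
    Q (x + t *: u) <= t * Q (x + u) + (1 - t) * Q x
      - K / 2 * t * (1 - t) * enorm u ^+ 2.
Proof.
have [k [eta [k0 eta0 H]]] := expected_second_diff_ge.
(* From [enorm u ^+ 2 <= s * |u| ^+ 2], division by [s + 1] gives the strict inequality [Ku], which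
   the local criterion requires. *)
exists (k / s.+1%:R) => [|x u t Vx Vxu t01]; first exact: divr_gt0.
set K := k / s.+1%:R; have K0 : 0 < K by exact: divr_gt0.
have [->|u0] := eqVneq u 0.
  have -> : enorm (0 : 'cV[R]_s) = 0.
    rewrite /enorm big1 ?sqrtr0// => i _; by rewrite mxE expr0n.
  by rewrite scaler0 !addr0 expr0n/=; lra.
have nu : 0 < `|u| by rewrite normr_gt0.
have Ku : K * enorm u ^+ 2 < k * `|u| ^+ 2.
  rewrite /K mulrAC ltr_pdivrMr// -mulrA ltr_pM2l//.
  apply: le_lt_trans (sqr_enorm_le _) _.
  by rewrite mulrC ltr_pM2l ?exprn_gt0// ltr_nat.
pose G (a : R) := Q (x + a *: u) - K / 2 * enorm u ^+ 2 * a ^+ 2.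
have cG : continuous G.
  have cQ : continuous (fun a : R => Q (x + a *: u)).
    apply: (@lipschitz_fun_continuous _ _ _ _ (L * `|u|)) => a b.
    apply: le_trans (lipschitz_expected A3 fL _ _) _.
    by rewrite opprD addrACA subrr add0r -scalerBl normrZ mulrAC mulrA.
  move=> a; apply: cvgB; first exact: cQ.
  by apply: cvgM; [exact: cvg_cst|exact: exprn_continuous].
have : G t <= t * G 1 + (1 - t) * G 0.
  apply: le_chord_of_local_strict_convexity => // {t t01} t /andP[t0 t1].
  (* This [h] keeps [t - h] and [t + h] in the unit interval and [h *: u] in the range of the
     curvature bound. *)
  pose h := Num.min (eta / `|u|) (Num.min t (1 - t)).
  have h0 : 0 < h by rewrite !lt_min divr_gt0// t0 subr_gt0.
  have ht : h <= t by rewrite !ge_min lexx orbT.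
  have ht1 : h <= 1 - t by rewrite !ge_min lexx !orbT.
  have hu : h * `|u| <= eta by rewrite -ler_pdivlMr// ge_min lexx.
  exists h; split; [by []|lra|lra|].
  have Vt : V (x + t *: u) by apply: convex_set_ray => //; lra.
  have := H (x + t *: u) (h *: u) Vt.
  rewrite normrZ gtr0_norm// => /(_ hu).
  rewrite /second_diff -!addrA -scalerBl -scalerDl /G => HQ.
  have : h ^+ 2 * (K * enorm u ^+ 2) < h ^+ 2 * (k * `|u| ^+ 2).
    by rewrite ltr_pM2l// exprn_gt0.
  by move: HQ; rewrite exprMn; lra.
by rewrite /G scale1r scale0r addr0; lra.
Qed.

(** A Markov-type argument: the box of radius [delta] around a point [y] of [V] has mass at least
    [p], and [|z| >= |y| - delta] on it, so the first moment [I] bounds [|y|]. *)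
Lemma domain_bounded : exists M : R, V `<=` cbox 0 M.
Proof.
pose p := r * (2 * delta) ^+ s.
have p0 : 0 < p by rewrite mulr_gt0// exprn_gt0// mulr_gt0.
have norm_lip : lipschitz_with 1 (fun z => `|z|).
  by move=> z z'; rewrite mul1r; exact: ler_dist_dist.
pose I := \int[mu]_z `|z|.
exists (I / p + delta) => y Vy; rewrite /cbox/= subr0 -lerBlDr ler_pdivlMr//.
have [yd|yd] := leP (`|y|) delta.
  apply: (@le_trans _ _ 0); last by apply: Rintegral_ge0.
  by apply: mulr_le0_ge0; lra.
have mB := measurable_cbox y delta.
have pmu : (p%:E <= mu (cbox y delta))%E.
  have := density_integral_ge A4_density A4_r mB (ae_cbox_density Vy)
    (k := fun z => (\1_(cbox y delta) z)%:E).
  rewrite integral_indic// setIid integral_indic// setIT => H.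
  rewrite /p EFinM.
  have <- : leb (cbox y delta) = ((2 * delta) ^+ s)%:E.
    by apply: lebesgue_vec_cbox; exact: ltW.
  by apply: H => //; exact/measurable_EFinP/measurable_indic.
apply: (@le_trans _ _ ((`|y| - delta) * fine (mu (cbox y delta)))).
  rewrite ler_pM2l ?subr_gt0// -lee_fin fineK//; exact: fin_num_measure.
rewrite -Rintegral_indicT// -RintegralZl//; last exact: integrable_indic.
apply: le_Rintegral => //.
- by apply: integrableRZ; exact: integrable_indic.
- exact: (lipschitz_integrable A3 norm_lip).
move=> z _; have [zB|zB] := pselect (cbox y delta z); last first.
  by rewrite indicE memNset// mulr0.
rewrite indicE mem_set// mulr1; move: zB; rewrite /cbox/=.
by have := ler_distD z y 0; rewrite !subr0 distrC; lra.
Qed.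

(** [beta y] integrates the positive part of [Q y - f (z - y)] truncated at 1. It is a lower bound
    for the mass, continuous in [y] and positive, so compactness of a box containing [V] gives a
    uniform bound. *)
Lemma below_mean_ge : exists2 alpha : R, 0 < alpha &
  forall y, V y -> alpha <= fine (mu [set z | f (z - y) <= Q y]).
Proof.
pose d y z := Num.max (Q y - f (z - y)) 0.
pose w y z := Num.min (d y z) 1.
pose beta y := \int[mu]_z w y z.
have QL := lipschitz_expected A3 fL.
have LL : 0 <= L + L by rewrite addr_ge0 ?(ltW L0).
have d_lip_x z : lipschitz_with (L + L) (d ^~ z).
  apply: lipschitz_max; last exact: lipschitz_withW (lipschitz_cst 0).
  move=> x y; have := QL x y; have /= := lipschitz_sub z fL x y.
  by rewrite !ler_norml; lra.
have d_lip_z y : lipschitz_with (L + L) (d y).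
  apply: lipschitz_max; last exact: lipschitz_withW (lipschitz_cst 0).
  move=> x x'; have /= := lipschitz_shift y fL x x'.
  rewrite !ler_norml => /andP[h1 h2].
  have : 0 <= L * `|x - x'| by rewrite mulr_ge0// ltW.
  lra.
have w_lip_x z : lipschitz_with (L + L) (w ^~ z).
  by apply: lipschitz_min => //; exact: lipschitz_withW (lipschitz_cst 1).
have w_lip_z y : lipschitz_with (L + L) (w y).
  by apply: lipschitz_min => //; exact: lipschitz_withW (lipschitz_cst 1).
have d_ge0 y z : 0 <= d y z by rewrite le_max lexx orbT.
have w_ge0 y z : 0 <= w y z by rewrite le_min d_ge0 ler01.
have iw y := lipschitz_integrable A3 (w_lip_z y).
have id_ y := lipschitz_integrable A3 (d_lip_z y).
have int0_ae (g : 'cV[R]_s -> R) : (forall z, 0 <= g z) ->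
    mu.-integrable setT (EFin \o g) -> \int[mu]_z g z = 0 -> {ae mu, forall z, g z = 0}.
  move=> g0 ig Ig; have /integrableP[mg _] := ig.
  have : (\int[mu]_z `|(EFin \o g) z| = 0)%E.
    rewrite (eq_integral (EFin \o g)); last by move=> z _; rewrite /= ger0_norm.
    by rewrite -[LHS]fineK ?integrable_fin_num// -[X in X%:E]/(\int[mu]_z g z) Ig.
  move=> /(ae_eq_integral_abs mu measurableT mg); apply: filterS => z /(_ I) /= [].
  by [].
(* If [beta y] were zero, [f (z - y)] would be at least its mean [Q y] almost everywhere, hence
   equal to it almost everywhere, against the nullity of level sets. *)
have beta_gt0 y : 0 < beta y.
  rewrite lt_neqAle Rintegral_ge0// andbT eq_sym; apply/eqP => beta0.
  have aew := int0_ae _ (w_ge0 y) (iw y) beta0.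
  have aed : {ae mu, forall z, d y z = 0}.
    move: aew; apply: filterS => z; rewrite /w; case: leP => // _.
    by move=> /eqP; rewrite oner_eq0.
  (* Adding [d y z], which vanishes almost everywhere, makes the integrand nonnegative at every
     point. *)
  pose g z := f (z - y) - Q y + d y z.
  have g_ge0 z : 0 <= g z.
    have : Q y - f (z - y) <= d y z by rewrite le_max lexx.
    rewrite /g; lra.
  have ifQ : mu.-integrable setT (EFin \o (fun z => f (z - y) - Q y)).
    apply: (lipschitz_integrable A3 (L := L)) => x x'.
    by rewrite opprB addrA subrK; exact: lipschitz_shift.
  have ig : mu.-integrable setT (EFin \o g) by exact: integrableRD.
  have Id : \int[mu]_z d y z = 0.
    rewrite /Rintegral (ae_eq_integral (cst 0%E)) ?integral0//.
    - by have /integrableP[] := id_ y.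
    - by move: aed; apply: filterS => z dz _; rewrite /= dz.
  have Ig : \int[mu]_z g z = 0.
    have mu1 : fine (mu setT) = 1 by rewrite probability_setT.
    have iQ : mu.-integrable setT (EFin \o cst (Q y)).
      exact: finite_measure_integrable_cst.
    have IQ : \int[mu]_z Q y = Q y by rewrite Rintegral_cst// -[RHS]mulr1 -mu1.
    rewrite /g RintegralD// Id addr0 RintegralB//; last exact: (integrable_sub A3 fL y).
    by rewrite IQ subrr.
  have aeg := int0_ae _ g_ge0 ig Ig.
  have : {ae mu, forall z : 'cV[R]_s, False}.
    have := ae_neq_level A4_density sf L0 fL A5 (Q y) y.
    apply: filterS3 aed aeg => z dz gz /negP; apply.
    by rewrite -subr_eq0; move: gz; rewrite /g dz addr0 => ->.
  move=> [N [mN N0 NT]]; have : mu N = 1%E.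
    rewrite (_ : N = setT) ?probability_setT//.
    by apply/seteqP; split => // z _; exact: NT.
  by rewrite N0 => /eqP; rewrite eq_sym onee_eq0.
have [M VM] := domain_bounded.
have [V0|/set0P[v0 Vv0]] := eqVneq V set0.
  by exists 1 => // y; rewrite V0.
have cbeta : continuous beta.
  apply: lipschitz_fun_continuous; apply: lipschitz_integral => //; exact: iw.
have [|y1 _ Hy1] := compact_EVT_min (ex_intro _ v0 (VM _ Vv0)) (@compact_cbox _ _ 0 M)
    (f := beta).
  exact: continuous_subspaceT.
exists (beta y1) => // y Vy; apply: (@le_trans _ _ (beta y)).
  by apply: Hy1; rewrite inE; exact: VM.
set S := mkset _.
have mS : measurable S.
  apply: closed_measurable_mx; apply: closed_sublevel.
  exact: lipschitz_fun_continuous (lipschitz_shift y fL).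
rewrite -Rintegral_indicT//; apply: le_Rintegral => //; first exact: integrable_indic.
move=> z _; rewrite indicE; have [zS|zS] := pselect (S z).
  by rewrite mem_set// /w ge_min lexx orbT.
rewrite memNset//; move/negP: zS; rewrite -ltNge => zS.
by rewrite /w /d [Num.max _ _]max_r ?min_l//; lra.
Qed.

Lemma expected_max_strongly_convex : exists2 K : R, 0 < K &
  forall x u (t : R), V x -> V (x + u) -> 0 <= t <= 1 ->
    F (x + t *: u) <= t * F (x + u) + (1 - t) * F x
      - K / 2 * t * (1 - t) * enorm u ^+ 2.
Proof.
have [K K0 HK] := expected_strongly_convex.
have [alpha alpha0 Halpha] := below_mean_ge.
(* The gain [a] of [Q] is collected on the set [S], of mass at least [alpha]. *)
exists (K * alpha) => [|x u t Vx Vxu t01]; first exact: mulr_gt0.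
pose y := x + t *: u; have Vy : V y by exact: convex_set_ray.
pose S := [set z | f (z - y) <= Q y].
pose a := K / 2 * t * (1 - t) * enorm u ^+ 2.
have a0 : 0 <= a.
  have [t0 t1] : 0 <= t /\ 0 <= 1 - t by lra.
  by rewrite mulr_ge0 ?sqr_ge0// mulr_ge0// mulr_ge0// divr_ge0// ltW.
have mS : measurable S.
  apply: closed_measurable_mx; apply: closed_sublevel.
  exact: lipschitz_fun_continuous (lipschitz_shift y fL).
have imax v := integrable_max A3 L0 fL v.
have i1S : mu.-integrable setT (EFin \o (\1_S : 'cV[R]_s -> R)).
  exact: integrable_indic.
have I1S := Rintegral_indicT mS.
have pw z : Num.max (Q y) (f (z - y)) <= t * Num.max (Q (x + u)) (f (z - (x + u)))
    + (1 - t) * Num.max (Q x) (f (z - x)) + - a * \1_S z.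
  have yE : y = t *: (x + u) + (1 - t) *: x.
    by rewrite scalerDr addrAC -scalerDl [t + _]addrC subrK scale1r.
  have [zS|zS] := pselect (S z).
    rewrite indicE mem_set// mulr1 max_l//.
    have := HK x u t Vx Vxu t01; rewrite -/y -/a.
    have [t0 t1] : 0 <= t /\ 0 <= 1 - t by lra.
    have := ler_wpM2l t0 (_ : Q (x + u) <= Num.max (Q (x + u)) (f (z - (x + u)))).
    have := ler_wpM2l t1 (_ : Q x <= Num.max (Q x) (f (z - x))).
    by rewrite !le_max !lexx => /(_ isT) ? /(_ isT) ?; lra.
  rewrite indicE memNset// mulr0 addr0 yE.
  exact: (convex_max_sub A3 sf fL).
have : F y <= \int[mu]_z (t * Num.max (Q (x + u)) (f (z - (x + u)))
    + (1 - t) * Num.max (Q x) (f (z - x)) + - a * \1_S z).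
  apply: le_Rintegral => //.
  apply: integrableRD; last exact: integrableRZ.
  by apply: integrableRD; exact: integrableRZ.
rewrite RintegralD//; [|by apply: integrableRD; exact: integrableRZ|exact: integrableRZ].
rewrite RintegralD//; [|exact: integrableRZ|exact: integrableRZ].
rewrite !RintegralZl// I1S.
have aS : a * alpha <= a * fine (mu S) by rewrite ler_wpM2l// Halpha.
move=> /le_trans; apply; rewrite mulNr lerD2l lerN2 (le_trans _ aS)//.
by rewrite le_eqVlt; apply/orP; left; apply/eqP; rewrite /a; ring.
Qed.

End strong_convexity.

(** * From strong convexity to monotonicity of the derivative *)

Lemma diff_le_strong_chord (R : realType) (V : normedModType R) (F : V -> R)
    (x u : V) (K : R) : differentiable F x -> 0 <= K ->
  (forall t, 0 <= t <= 1 ->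
    F (x + t *: u) <= t * F (x + u) + (1 - t) * F x - K * t * (1 - t)) ->
  'd F x u <= F (x + u) - F x - K.
Proof.
move=> dF K0 HF; rewrite -deriveE//.
have /cvgrPdist_le dcvg : h^-1 *: ((F \o shift x) (h *: u) - F x) @[h --> 0^'] --> 'D_u F x.
  exact: (diff_derivable dF).
apply/ler_addgt0Pl => eps eps0.
have [|d /= d0 Hd] := dcvg (eps / 2); first by rewrite divr_gt0.
(* This [h] puts the difference quotient within [eps / 2] of the derivative and makes [K * h] at
   most [eps / 2]. *)
pose h := Num.min (d / 2) (Num.min 1 (eps / (2 * (K + 1)))).
have h0 : 0 < h by rewrite !lt_min !divr_gt0// ?ltr01// mulr_gt0// ltr_wpDl.
have hd : h <= d / 2 by rewrite ge_min lexx.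
have h1 : h <= 1 by rewrite !ge_min lexx orbT.
have hK : h * (2 * (K + 1)) <= eps.
  by rewrite -ler_pdivlMr ?mulr_gt0 ?ltr_wpDl// !ge_min lexx !orbT.
have := Hd h; rewrite /ball_/= sub0r normrN gtr0_norm// => /(_ ltac:(lra)).
move=> /(_ (lt0r_neq0 h0)) /(le_trans (ler_norm _)).
(* Division of the chord inequality by [h] leaves the loss [K * (1 - h)], which tends to [K] with
   vanishing [h]. *)
have : h^-1 *: (F (h *: u + x) - F x) <= F (x + u) - F x - K * (1 - h).
  rewrite -[_ *: _]/(h^-1 * _) mulrC ler_pdivrMr// [h *: u + x]addrC.
  by have := HF h ltac:(lra); lra.
have Kh : K * h <= eps / 2 by nra.
by lra.
Qed.

(** Here [a] and [b] stand for the derivatives at [x] and [x + u] in direction [u], and [p], [p']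
    for the values at [x + u] and [x], which cancel when the two bounds are added. *)
Lemma sum_opposite_bounds (R : realType) (a b p p' k : R) :
  a <= p - p' - k -> - b <= p' - p - k -> 2 * k <= b - a.
Proof. lra. Qed.

Theorem theorem3p6 (R : realType) (s m : nat)
    (W : 'M[R]_(s, m)) (q : 'cV[R]_m) (mu : probability 'cV[R]_s R)
    (theta : 'cV[R]_s -> R) (V : set 'cV[R]_s) (r rho : R)
    (A1 : forall t : 'cV[R]_s, exists y : 'cV[R]_m,
      (forall j, 0 <= y j 0) /\ W *m y = t)
    (A2 : exists xi : 'cV[R]_s, forall j, (W^T *m xi) j 0 < q j 0)
    (A3 : (\int[mu]_z (enorm z)%:E < +oo)%E)
    (A4_density : is_density theta mu)
    (A4_convex : convex_set V) (A4_open : open V)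
    (A4_r : 0 < r) (A4_rho : 0 < rho)
    (A4_bound : {ae lebesgue_vec R s, forall z,
      [set v + b | v in V & b in eball rho] z -> r <= theta z})
    (A5 : forall x : 'cV[R]_s,
      mu [set z | lp_value W q (z - x) = 0] = 0%E) :
  (exists C : 'cV[R]_s -> R,
    [/\ continuous C,
        forall u, 0 <= C u,
        C u @[u --> (0 : 'cV[R]_s)] --> (0 : R),
        forall u, u != 0 -> 0 < C u &
        forall x u, V x -> V (x + u) ->
          'd (QDplus W q mu) (x + u) u - 'd (QDplus W q mu) x u
            >= C u * enorm u ^+ 2]) /\
  ((forall j, 0 <= q j 0) -> strongly_convex_on V (QDplus W q mu)).
Proof.
have sf := lp_value_sublinear A1 A2.
have [L0 f_L0] := sublinear_lipschitz sf.
have [L L_gt0 fL] : exists2 L : R, 0 < L & lipschitz_with L (lp_value W q).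
  exists (`|L0| + 1); first by rewrite ltr_wpDl.
  by apply: lipschitz_withW f_L0; rewrite (le_trans (ler_norm _))// lerDl.
have [c c0 fc] := lp_value_coercive A1 A2.
have [K K0 HK] := expected_max_strongly_convex A3 A4_density sf L_gt0 fL c0 fc A5
  A4_convex A4_r A4_rho A4_bound.
have dF x : differentiable (QDplus W q mu) x.
  exact: (expected_max_differentiable A3 A4_density sf L_gt0 fL A5).
split; last first.
  move=> _; exists K => // x x' t Vx Vx' t01.
  have := HK x (x' - x) t Vx; rewrite [x + (x' - x)]addrC subrK => /(_ Vx' t01).
  have -> : x + t *: (x' - x) = t *: x' + (1 - t) *: x.
    by rewrite scalerBr scalerBl scale1r addrCA.
  exact.
have minL : lipschitz_with 1 (fun u : 'cV[R]_s => Num.min 1 `|u|).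
  apply: lipschitz_min; first exact: lipschitz_withW ler01 (lipschitz_cst 1).
  by move=> u v; rewrite mul1r; exact: ler_dist_dist.
have cC : continuous (fun u : 'cV[R]_s => K * Num.min 1 `|u|).
  apply: (@lipschitz_fun_continuous _ _ _ _ K) => u v.
  rewrite -mulrBr normrM gtr0_norm// ler_wpM2l ?(ltW K0)//.
  by have := minL u v; rewrite mul1r.
(* The modulus [K] is constant; the factor [Num.min 1 |u|] makes [C] vanish at the origin and only
   weakens the estimate. *)
exists (fun u => K * Num.min 1 `|u|); split=> //.
- by move=> u; rewrite mulr_ge0 ?(ltW K0)// le_min ler01 normr_ge0.
- have C0 : K * Num.min 1 `|0 : 'cV[R]_s| = 0 by rewrite normr0 min_r ?ler01// mulr0.
  by have := cC 0; rewrite /continuous_at C0.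
- by move=> u u0; rewrite mulr_gt0// lt_min ltr01 normr_gt0.
move=> x u Vx Vxu.
have E0 := sqr_ge0 (enorm u); set E := enorm u ^+ 2 in E0 *.
have KE : 0 <= K / 2 * E by rewrite mulr_ge0// divr_ge0// ltW.
have H1 : 'd (QDplus W q mu) x u <= QDplus W q mu (x + u) - QDplus W q mu x - K / 2 * E.
  apply: diff_le_strong_chord => // t t01; have := HK x u t Vx Vxu t01.
  by move=> /le_trans; apply; rewrite -/E lerD2l lerN2 le_eqVlt; apply/orP; left;
    apply/eqP; ring.
(* The same chord bound, taken from the other end of the segment in direction [- u]. *)
have H2 : 'd (QDplus W q mu) (x + u) (- u) <=
    QDplus W q mu x - QDplus W q mu (x + u) - K / 2 * E.
  have := @diff_le_strong_chord _ _ (QDplus W q mu) (x + u) (- u) (K / 2 * E) (dF _) KE.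
  rewrite addrK; apply => t t01; have := HK (x + u) (- u) t Vxu; rewrite addrK.
  have -> : enorm (- u) ^+ 2 = E.
    by rewrite /E !sqr_enorm; apply: eq_bigr => i _; rewrite mxE sqrrN.
  move=> /(_ Vx t01)/le_trans; apply; rewrite lerD2l lerN2 le_eqVlt; apply/orP; left.
  by apply/eqP; ring.
rewrite linearN in H2.
have CE : K * Num.min 1 `|u| * E <= K * E.
  by rewrite ler_wpM2r// ger_pMr// ge_min lexx.
apply: le_trans CE _; rewrite (_ : K * E = 2 * (K / 2 * E)); last by field.
exact: sum_opposite_bounds H1 H2.
Qed.
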